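(* Let $\mathsf C$ be an operator space coalgebra, $\mathsf k$ a Hilbert space and $\varphi\in CB(\mathsf C;B(\hat{\mathsf k}))$. Then the process $l^\varphi$ is a weak QS convolution cocycle on $\mathsf C$, whose associated convolution semigroups are norm continuous.
   Context: Inner products are linear in the second variable; $\otimes$ of operator spaces is the spatial tensor product; operator spaces are concrete. An operator space (OS) coalgebra is an operator space $\mathsf C$ with completely contractive maps $\Delta:\mathsf C\to\mathsf C\otimes\mathsf C$, $\epsilon:\mathsf C\to\mathbb C$ satisfying coassociativity and the counit property $(\mathrm{id}\otimes\epsilon)\Delta=(\epsilon\otimes\mathrm{id})\Delta=\mathrm{id}$. For completely bounded maps $\varphi_i$ on $\mathsf C$, $\varphi_1\star\varphi_2=(\varphi_1\otimes\varphi_2)\circ\Delta$. $\omega_{\xi,\eta}(T)=\langle\xi,T\eta\rangle$. $\hat{\mathsf k}=\mathbb C\oplus\mathsf k$; $\hat c=(1,c)$; $\hat f(s)=\widehat{f(s)}$. $\mathcal F=\Gamma(L^2(\mathbb R_+;\mathsf k))$ is the symmetric Fock space with exponential vectors $\varepsilon(f)=\sum_n(n!)^{-1/2}f^{\otimes n}$; $\mathbb S=\mathrm{Lin}\{d1_{[0,s)}:d\in\mathsf k,s\ge0\}$; $\mathcal E=\mathrm{Lin}\{\varepsilon(f):f\in\mathbb S\}$; $\mathcal F=\mathcal F_{[0,t)}\otimes\mathcal F_{[t,\infty)}$ with $\mathcal F_J=\Gamma(L^2(J;\mathsf k))$. For a function or vector $h$ and interval $J$, $h_J$ denotes the function agreeing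 with (the constant) $h$ on $J$ and zero elsewhere. A process on $\mathsf C$ is a linear map $a\mapsto(k_t(a))_{t\ge0}$ where the $k_t(a)$ are linear operators in $\mathcal F$ with domain $\mathcal E$, weakly measurable in $t$ on each vector of $\mathcal E$ and adapted: $k_t(a)\varepsilon(f)=X(t)\varepsilon(f|_{[0,t)})\otimes\varepsilon(f|_{[t,\infty)})$ for some operator $X(t)$. It is weakly bounded if for all $t\ge0$, $f,g\in\mathbb S$ the functional $a\mapsto\langle\varepsilon(f),k_t(a)\varepsilon(g)\rangle$ is bounded. $l^\varphi$ denotes the unique weak solution of $dk_t=k_t\star_\tau\varphi\,d\Lambda_t$, $k_0=\iota\circ\epsilon$: the unique weakly bounded process $k$ on $\mathsf C$ with $$\langle\varepsilon(f),(k_t(a)-\epsilon(a)I)\varepsilon(g)\rangle=\int_0^t\big((\omega_{\varepsilon(f),\varepsilon(g)}\circ k_s)\star(\omega_{\hat f(s),\hat g(s)}\circ\varphi)\big)(a)\,ds$$ for all $f,g\in\mathbb S$, $t\ge0$, $a\in\mathsf C$. For a weakly bounded process $l$ on $\mathsf C$ and $c,d\in\mathsf k$ put $\lambda^{c,d}_t=e^{-t\langle c,d\rangle}\langle\varepsilon(c_{[0,t)}),l_t(\cdot)\varepsilon(d_{[0,t)})\rangle\in\mathsf C^*$. The process $l$ is a weak QS convolution cocycle if $l_0(a)=\epsilon(a)I$ for all $a$ and, for all $f,g\in\mathbb S$, $t\ge0$, $a\in\mathsf C$, $$e^{-\langle f_{[0,t)},g_{[0,t)}\rangle}\langle\varepsilon(f_{[0,t)}),l_t(a)\varepsilon(g_{[0,t)})\rangle=\big(\lambda^{f(t_0),g(t_0)}_{t_1-t_0}\star\cdots\star\lambda^{f(t_{n-1}),g(t_{n-1})}_{t_n-t_{n-1}}\big)(a)$$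 whenever $0=t_0\le t_1\le\cdots\le t_n=t$ contains the discontinuities of $f_{[0,t)}$ and $g_{[0,t)}$. Then each $(\lambda^{c,d}_t)_{t\ge0}$ is a convolution semigroup of functionals ($\lambda_{s+t}=\lambda_s\star\lambda_t$, $\lambda_0=\epsilon$); these are the associated convolution semigroups of $l$. Norm continuous means $\|\lambda_t-\epsilon\|\to0$ as $t\to0^+$. *)

(* Defs.v *)
From HB Require Import structures.
From mathcomp Require Import all_boot all_order all_algebra.
From mathcomp Require Import complex ring.
From mathcomp Require Import all_classical all_reals all_analysis.
Set Implicit Arguments. Unset Strict Implicit. Unset Printing Implicit Defensive.
Import Order.TTheory GRing.Theory Num.Theory.
Import numFieldNormedType.Exports.
Local Open Scope classical_set_scope.
Local Open Scope ring_scope.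
Local Open Scope complex_scope.

HB.mixin Record NormedModule_isInner (R : realType) V
    of NormedModule R[i] V := {
  dot : V -> V -> R[i];
  dotPr : forall x y z (a : R[i]), dot x (a *: y + z) = a * dot x y + dot x z;
  dotC : forall x y, dot y x = (dot x y)^*;
  dotxx : forall x, dot x x = `|x| ^+ 2 }.

(* Complex Hilbert spaces; dot is linear in the second variable. *)
#[short(type="hilbertType")]
HB.structure Definition Hilbert (R : realType) :=
  {V of CompleteNormedModule R[i] V & NormedModule_isInner R V}.

(* Norms over R[i] take values in R[i]; rnorm is the norm as a real number. *)
Definition rnorm (R : realType) (V : normedZmodType R[i]) (x : V) : R :=
  complex.Re `|x|.

Section RealNorm.
Context {R : realType} {V : normedZmodType R[i]}.
Implicit Types x y : V.

Lemma rnormE x : `|x| = (rnorm x)%:C :> R[i].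
Proof.
rewrite /rnorm; have := normr_ge0 x; case: `|x| => a b.
by rewrite lecE /= => /andP[/eqP -> _].
Qed.

Lemma rnorm_ge0 x : 0 <= rnorm x.
Proof. by have := normr_ge0 x; rewrite rnormE lecR. Qed.

Lemma rnorm0 : rnorm (0 : V) = 0.
Proof. by rewrite /rnorm normr0. Qed.

Lemma rnorm_eq0 x : rnorm x = 0 -> x = 0.
Proof. by move=> h; apply/eqP; rewrite -normr_eq0 rnormE h. Qed.

Lemma rnormD x y : rnorm (x + y) <= rnorm x + rnorm y.
Proof. by have := ler_normD x y; rewrite !rnormE -rmorphD lecR. Qed.

End RealNorm.

Lemma rnormZ (R : realType) (V : normedModType R[i]) (a : R[i]) (x : V) :
  rnorm (a *: x) = rnorm a * rnorm x.
Proof. by apply: (@complexI R); rewrite -rnormE normrZ !rnormE rmorphM. Qed.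

(* B(H), made below into a normed space by the operator norm. *)
Record bop (R : realType) (H : normedModType R[i]) := Bop {
  bop_fun :> H -> H;
  bop_linear : linear bop_fun;
  bop_bounded : exists M : R, forall x, rnorm (bop_fun x) <= M * rnorm x }.

Section BoundedOperators.
Context {R : realType} {H : normedModType R[i]}.
Implicit Types (S T : bop H) (x : H).

HB.instance Definition _ := gen_eqMixin (bop H).
HB.instance Definition _ := gen_choiceMixin (bop H).
HB.instance Definition _ (T : bop H) :=
  GRing.isLinear.Build R[i] H H _ (bop_fun T) (bop_linear T).

Lemma bopP S T : (forall x, S x = T x) -> S = T.
Proof.
case: S T => [f lf bf] [g lg bg] /= /funext fg; subst g.
by congr Bop; exact: Prop_irrelevance.
Qed.

Lemma bop_bound T :
  exists2 M : R, 0 <= M & forall x, rnorm (T x) <= M * rnorm x.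
Proof.
have [M hM] := bop_bounded T; exists (Num.max 0 M).
  by rewrite le_max lexx.
move=> x; apply: (le_trans (hM x)); rewrite ler_wpM2r ?rnorm_ge0//.
by rewrite le_max lexx orbT.
Qed.

Program Definition bop_zero : bop H := @Bop R H (fun=> 0) _ _.
Next Obligation. by move=> a x y; rewrite scaler0 addr0. Qed.
Next Obligation. by exists 0 => x; rewrite rnorm0 mul0r. Qed.

Program Definition bop_comb (a : R[i]) S T : bop H :=
  @Bop R H (fun x => a *: S x + T x) _ _.
Next Obligation.
move=> a S T b x y; rewrite !bop_linear !scalerDr !scalerA (mulrC a b).
by rewrite addrACA.
Qed.
Next Obligation.
move=> a S T; have [M M0 hM] := bop_bound S; have [N N0 hN] := bop_bound T.
exists (rnorm a * M + N) => x; rewrite mulrDl; apply: le_trans (rnormD _ _) _.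
by rewrite lerD// rnormZ -mulrA ler_wpM2l ?rnorm_ge0.
Qed.

Let add S T := bop_comb 1 S T.
Let opp T := bop_comb (-1) T bop_zero.
Let scale (a : R[i]) T := bop_comb a T bop_zero.

Let addA : associative add.
Proof. by move=> S T U; apply: bopP => x /=; rewrite !scale1r addrA. Qed.
Let addC : commutative add.
Proof. by move=> S T; apply: bopP => x /=; rewrite !scale1r addrC. Qed.
Let add0 : left_id bop_zero add.
Proof. by move=> S; apply: bopP => x /=; rewrite !scale1r add0r. Qed.
Let addN : left_inverse bop_zero opp add.
Proof.
by move=> S; apply: bopP => x /=; rewrite !scale1r addr0 scaleN1r addNr.
Qed.
HB.instance Definition _ :=
  GRing.isZmodule.Build (bop H) addA addC add0 addN.

Let scaleA a b T : scale a (scale b T) = scale (a * b) T.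
Proof. by apply: bopP => x /=; rewrite !addr0 scalerA. Qed.
Let scale1 : left_id 1 scale.
Proof. by move=> T; apply: bopP => x /=; rewrite addr0 scale1r. Qed.
Let scaleDr : right_distributive scale +%R.
Proof.
by move=> a S T; apply: bopP => x /=; rewrite !addr0 !scale1r scalerDr.
Qed.
Let scaleDl T : {morph scale^~ T : a b / a + b}.
Proof. by move=> a b; apply: bopP => x /=; rewrite !addr0 scale1r scalerDl. Qed.
HB.instance Definition _ := GRing.Zmodule_isLmodule.Build R[i] (bop H)
  scaleA scale1 scaleDr scaleDl.

Lemma bopD S T x : (S + T) x = S x + T x. Proof. by rewrite /= scale1r. Qed.
Lemma bopZ a T x : (a *: T) x = a *: T x. Proof. by rewrite /= addr0. Qed.

Definition opnorm T : R := sup [set rnorm (T x) | x in [set x | rnorm x <= 1]].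

Lemma opnorm_has_sup T :
  has_sup [set rnorm (T x) | x in [set x | rnorm x <= 1]].
Proof.
split; first by exists (rnorm (T 0)); exists 0 => //=; rewrite rnorm0.
have [M M0 hM] := bop_bound T; exists M => _ [x /= x1 <-].
by apply: (le_trans (hM x)); rewrite -[leRHS]mulr1 ler_wpM2l.
Qed.

Lemma opnorm_ge0 T : 0 <= opnorm T.
Proof.
apply: (le_trans (rnorm_ge0 (T 0))); apply: ub_le_sup.
  exact: (opnorm_has_sup T).2.
by exists 0 => //=; rewrite rnorm0.
Qed.

Lemma opnorm_bound T x : rnorm (T x) <= opnorm T * rnorm x.
Proof.
have [x0|x0] := eqVneq (rnorm x) 0.
  by rewrite x0 mulr0 (rnorm_eq0 x0) linear0 rnorm0.
have xp : 0 < rnorm x by rewrite lt_def x0 rnorm_ge0.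
have nV : rnorm ((rnorm x)^-1)%:C = (rnorm x)^-1.
  by rewrite /rnorm ger0_norm// lecR invr_ge0 ltW.
rewrite -ler_pdivrMr// mulrC -nV -rnormZ -linearZ; apply: ub_le_sup.
  exact: (opnorm_has_sup T).2.
by exists (((rnorm x)^-1)%:C *: x) => //=; rewrite rnormZ nV mulVf.
Qed.

Lemma opnorm_le T M : 0 <= M ->
  (forall x, rnorm (T x) <= M * rnorm x) -> opnorm T <= M.
Proof.
move=> M0 hM; apply: ge_sup; first exact: (opnorm_has_sup T).1.
by move=> _ [x /= x1 <-]; apply: (le_trans (hM x)); rewrite -[leRHS]mulr1 ler_wpM2l.
Qed.

Let norm T : R[i] := (opnorm T)%:C.

Let normD S T : norm (S + T) <= norm S + norm T.
Proof.
rewrite -rmorphD lecR; apply: opnorm_le; first by rewrite addr_ge0 ?opnorm_ge0.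
move=> x; rewrite bopD mulrDl; apply: (le_trans (rnormD _ _)).
by rewrite lerD// opnorm_bound.
Qed.

Let normZle a T : opnorm (a *: T) <= rnorm a * opnorm T.
Proof.
apply: opnorm_le; first by rewrite mulr_ge0 ?opnorm_ge0 ?rnorm_ge0.
by move=> x; rewrite bopZ rnormZ -mulrA ler_wpM2l ?rnorm_ge0 ?opnorm_bound.
Qed.

Let normZ a T : norm (a *: T) = `|a| * norm T.
Proof.
rewrite rnormE -rmorphM; congr (_%:C); apply/eqP; rewrite eq_le normZle/=.
have [->|a0] := eqVneq a 0; first by rewrite rnorm0 mul0r opnorm_ge0.
have ap : 0 < rnorm a.
  by rewrite lt_def rnorm_ge0 andbT; apply: contraNneq a0 => /rnorm_eq0 ->.
rewrite -ler_pdivlMl//; have {1}-> : T = a^-1 *: (a *: T).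
  by rewrite scalerA mulVf ?scale1r.
apply: (le_trans (normZle _ _)).
suff -> : rnorm a^-1 = (rnorm a)^-1 by [].
by apply: (@complexI R); rewrite -rnormE normfV rnormE fmorphV.
Qed.

Let norm0_eq0 T : norm T = 0 -> T = 0.
Proof.
move=> [T0]; apply: bopP => x; apply: rnorm_eq0; apply/eqP.
by rewrite eq_le rnorm_ge0 andbT (le_trans (opnorm_bound T x))// T0 mul0r.
Qed.

HB.instance Definition _ := Lmodule_isNormed.Build R[i] (bop H)
  normD normZ norm0_eq0.

Lemma rnorm_bopE T : rnorm T = opnorm T. Proof. by []. Qed.

End BoundedOperators.

Section ComplexComplete.
Context {R : realType}.
Implicit Types z w : R[i].

Let ReB z w : complex.Re (z - w) = complex.Re z - complex.Re w.
Proof. by case: z; case: w. Qed.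

Let ImB z w : complex.Im (z - w) = complex.Im z - complex.Im w.
Proof. by case: z; case: w. Qed.

Let Re_le z : `|complex.Re z|%:C <= `|z|.
Proof. exact: normc_ge_Re. Qed.

Let Im_le z : `|complex.Im z|%:C <= `|z|.
Proof.
rewrite normc_def lecR -(@ler_pXn2r _ 2)// ?nnegrE ?sqrtr_ge0//.
by rewrite sqr_sqrtr ?addr_ge0 ?sqr_ge0// real_normK ?num_real// lerDr sqr_ge0.
Qed.

Let le_ReIm z : `|z| <= (`|complex.Re z| + `|complex.Im z|)%:C.
Proof.
rewrite normc_def lecR -(@ler_pXn2r _ 2)// ?nnegrE ?sqrtr_ge0 ?addr_ge0//.
rewrite sqr_sqrtr ?addr_ge0 ?sqr_ge0// sqrrD !real_normK ?num_real//.
by rewrite addrAC lerDl mulrn_wge0// mulr_ge0.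
Qed.

Lemma complex_complete (F : set_system R[i]^o) :
  ProperFilter F -> cauchy F -> cvg F.
Proof.
move=> FF /cauchyP Fc.
have Rec : cauchy (@complex.Re R @ F).
  apply/cauchyP => e e0; have [|z Fz] := Fc e%:C; first by rewrite ltcR.
  exists (complex.Re z); change (F (@complex.Re R @^-1` ball (complex.Re z) e)).
  apply: filterS Fz => w /=.
  rewrite -!ball_normE /= => zw; rewrite -ltcR; apply: le_lt_trans zw.
  by rewrite -ReB; exact: Re_le.
have Imc : cauchy (@complex.Im R @ F).
  apply/cauchyP => e e0; have [|z Fz] := Fc e%:C; first by rewrite ltcR.
  exists (complex.Im z); change (F (@complex.Im R @^-1` ball (complex.Im z) e)).
  apply: filterS Fz => w /=.
  rewrite -!ball_normE /= => zw; rewrite -ltcR; apply: le_lt_trans zw.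
  by rewrite -ImB; exact: Im_le.
have /cauchy_cvg/cvg_ex[a Fa] := Rec.
have /cauchy_cvg/cvg_ex[b Fb] := Imc.
apply/cvg_ex; exists (a +i* b); apply/cvgrPdist_lt => -[e e'].
rewrite ltcE /= => /andP[/eqP -> e0].
have e20 : 0 < e / 2 by rewrite divr_gt0.
near=> z; apply: (le_lt_trans (le_ReIm _)); rewrite ltcR ReB ImB /=.
rewrite [ltRHS](splitr e) ltrD//.
  by near: z; move/cvgrPdist_lt: Fa; apply.
by near: z; move/cvgrPdist_lt: Fb; apply.
Unshelve. all: by end_near. Qed.

End ComplexComplete.

(* The Hilbertian direct sum of R[i] and k. *)
Definition khat (R : realType) (k : hilbertType R) : Type := (R[i] * k)%type.

Section Khat.
Context {R : realType} {k : hilbertType R}.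
Implicit Types u v w : khat k.

HB.instance Definition _ := GRing.Lmodule.copy (khat k) (R[i] * k)%type.

Let kdot u v : R[i] := (u.1)^* * v.1 + dot u.2 v.2.
Let knorm u : R[i] := sqrtC (`|u.1| ^+ 2 + `|u.2| ^+ 2).

Let knorm2_ge0 u : 0 <= `|u.1| ^+ 2 + `|u.2| ^+ 2 :> R[i].
Proof. by rewrite addr_ge0 ?exprn_ge0. Qed.

Let knorm_ge0 u : 0 <= knorm u.
Proof. by rewrite sqrtC_ge0 knorm2_ge0. Qed.

Let knormK u : knorm u ^+ 2 = `|u.1| ^+ 2 + `|u.2| ^+ 2.
Proof. exact: sqrtCK. Qed.

Let knormD u v : knorm (u + v) <= knorm u + knorm v.
Proof.
rewrite -(@ler_pXn2r _ 2)// ?nnegrE ?addr_ge0 ?knorm_ge0//.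
rewrite sqrrD !knormK.
pose a := `|u.1|; pose b := `|u.2|; pose c := `|v.1|; pose d := `|v.2|.
have [a0 b0 c0 d0] : [/\ 0 <= a, 0 <= b, 0 <= c & 0 <= d].
  by rewrite /a /b /c /d !normr_ge0.
have h1 : `|(u + v).1| ^+ 2 <= (a + c) ^+ 2.
  by rewrite ler_pXn2r ?nnegrE ?addr_ge0// ler_normD.
have h2 : `|(u + v).2| ^+ 2 <= (b + d) ^+ 2.
  by rewrite ler_pXn2r ?nnegrE ?addr_ge0// ler_normD.
apply: (le_trans (lerD h1 h2)).
suff cs : a * c + b * d <= knorm u * knorm v.
  rewrite -/a -/b -/c -/d.
  have -> : (a + c) ^+ 2 + (b + d) ^+ 2 =
      (a ^+ 2 + b ^+ 2) + (a * c + b * d) *+ 2 + (c ^+ 2 + d ^+ 2).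
    by rewrite !sqrrD !mulrnDl; ring.
  by rewrite lerD// lerD// lerMn2r cs orbT.
rewrite -(@ler_pXn2r _ 2)// ?nnegrE ?mulr_ge0 ?addr_ge0 ?mulr_ge0 ?knorm_ge0//.
rewrite exprMn !knormK -/a -/b -/c -/d -subr_ge0.
have -> : (a ^+ 2 + b ^+ 2) * (c ^+ 2 + d ^+ 2) - (a * c + b * d) ^+ 2
    = (a * d - b * c) ^+ 2 by ring.
by rewrite real_exprn_even_ge0// realB// ger0_real// mulr_ge0.
Qed.

Let knormZ (a : R[i]) u : knorm (a *: u) = `|a| * knorm u.
Proof.
apply: (@pexpIrn _ 2) => //; rewrite ?nnegrE ?mulr_ge0 ?knorm_ge0//.
by rewrite exprMn !knormK /= normrM normrZ !exprMn mulrDr.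
Qed.

Let knorm0_eq0 u : knorm u = 0 -> u = 0.
Proof.
move=> u0; have := knormK u; rewrite u0 expr0n/= => /esym/eqP.
rewrite paddr_eq0 ?exprn_ge0// !expf_eq0/= !normr_eq0 => /andP[/eqP h1 /eqP h2].
by rewrite [u]surjective_pairing h1 h2.
Qed.

HB.instance Definition _ := Lmodule_isNormed.Build R[i] (khat k)
  knormD knormZ knorm0_eq0.

Lemma khat_normE u : `|u| = sqrtC (`|u.1| ^+ 2 + `|u.2| ^+ 2) :> R[i].
Proof. by []. Qed.

Let norm1_le u : `|u.1| <= `|u|.
Proof.
rewrite khat_normE -[leLHS]sqrCK// ler_sqrtC ?nnegrE ?knorm2_ge0 ?exprn_ge0//.
by rewrite lerDl exprn_ge0.
Qed.

Let norm2_le u : `|u.2| <= `|u|.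
Proof.
rewrite khat_normE -[leLHS]sqrCK// ler_sqrtC ?nnegrE ?knorm2_ge0 ?exprn_ge0//.
by rewrite lerDr exprn_ge0.
Qed.

Let norm_le u : `|u| <= `|u.1| + `|u.2|.
Proof.
rewrite khat_normE -[leRHS]sqrCK ?addr_ge0//.
rewrite ler_sqrtC ?nnegrE ?knorm2_ge0 ?exprn_ge0 ?addr_ge0//.
by rewrite sqrrD addrAC lerDl mulrn_wge0// mulr_ge0.
Qed.

Lemma khat_complete (F : set_system (khat k)) :
  ProperFilter F -> cauchy F -> cvg F.
Proof.
move=> FF /cauchyP Fc.
pose f1 (u : khat k) : R[i]^o := u.1; pose f2 (u : khat k) : k := u.2.
have Fc1 : cauchy (f1 @ F).
  apply/cauchyP => e e0; have [z Fz] := Fc e e0.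
  exists (f1 z); change (F (f1 @^-1` ball (f1 z) e)).
  apply: filterS Fz => w /=.
  by rewrite -!ball_normE /=; apply: le_lt_trans; exact: (norm1_le (z - w)).
have Fc2 : cauchy (f2 @ F).
  apply/cauchyP => e e0; have [z Fz] := Fc e e0.
  exists (f2 z); change (F (f2 @^-1` ball (f2 z) e)).
  apply: filterS Fz => w /=.
  by rewrite -!ball_normE /=; apply: le_lt_trans; exact: (norm2_le (z - w)).
have /complex_complete/cvg_ex[a Fa] := Fc1.
have /cauchy_cvg/cvg_ex[b Fb] := Fc2.
apply/cvg_ex; exists ((a, b) : khat k); apply/cvgrPdist_lt => e e0.
have e20 : 0 < e / 2 by rewrite divr_gt0.
near=> z.
apply: (le_lt_trans (norm_le _)); rewrite [ltRHS](splitr e) ltrD//.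
  by near: z; move/cvgrPdist_lt: Fa; apply.
by near: z; move/cvgrPdist_lt: Fb; apply.
Unshelve. all: by end_near. Qed.

HB.instance Definition _ := Uniform_isComplete.Build (khat k) khat_complete.

Let kdotP u v w (a : R[i]) : kdot u (a *: v + w) = a * kdot u v + kdot u w.
Proof.
rewrite /kdot /= dotPr mulrDr mulrCA mulrDr.
by rewrite -!addrA; congr (_ + _); rewrite addrCA.
Qed.

Let kdotC u v : kdot v u = (kdot u v)^*.
Proof. by rewrite /kdot rmorphD rmorphM/= conjcK -dotC mulrC. Qed.

Let kdotxx u : kdot u u = `|u| ^+ 2.
Proof. rewrite [`|u|]khat_normE sqrtCK /kdot dotxx; congr (_ + _). by rewrite mulrC -sqr_normc. Qed.

HB.instance Definition _ := NormedModule_isInner.Build R (khat k)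
  kdotP kdotC kdotxx.

Lemma khat_dotE u v : dot u v = (u.1)^* * v.1 + dot u.2 v.2.
Proof. by []. Qed.

End Khat.


Section LinearMaps.
Context {R : realType}.

Definition lin (V : lmodType R[i]) (A : set V) : set V :=
  [set x | exists n (a : 'I_n -> R[i]) (v : 'I_n -> V),
     (forall i, A (v i)) /\ x = \sum_(i < n) a i *: v i].

(* Maps on a subspace are total functions on the ambient space of which only
   the values on the subspace matter. *)
Definition linear_on (U V : lmodType R[i]) (A : set U) (f : U -> V) : Prop :=
  forall (a : R[i]) x y, A x -> A y -> f (a *: x + y) = a *: f x + f y.

(* The norm of the matrix (T i j), acting on the Hilbertian sum V^n. *)
Definition mxopnorm (V : normedModType R[i]) n (T : 'I_n -> 'I_n -> V -> V) : R :=
  sup [set Num.sqrt (\sum_i rnorm (\sum_j T i j (x j)) ^+ 2)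
      | x in [set x : 'I_n -> V | \sum_i rnorm (x i) ^+ 2 <= 1]].

Definition bop_mxnorm (V : normedModType R[i]) n (A : 'M[bop V]_n) : R :=
  mxopnorm (fun i j => A i j : V -> V).

Definition scalar_mxnorm n (A : 'M[R[i]^o]_n) : R :=
  mxopnorm (fun i j (z : R[i]^o) => A i j * z).

(* All the amplifications of f : A -> Y have norm at most M. *)
Definition cb_le (X Y : Type) (nuX : forall n, 'M[X]_n -> R)
    (nuY : forall n, 'M[Y]_n -> R) (A : set X) (f : X -> Y) (M : R) : Prop :=
  forall n (a : 'M[X]_n), (forall i j, A (a i j)) ->
    nuY n (map_mx f a) <= M * nuX n a.

End LinearMaps.

Section Tensor.
Context {R : realType}.

(* m realizes T as the Hilbert space tensor product of the closed subspaces
   A and B. *)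
Record hilbert_tensor (H K T : hilbertType R) (A : set H) (B : set K)
    (m : H -> K -> T) : Prop := HilbertTensor {
  tens_linl : forall y, B y -> linear_on A (m^~ y);
  tens_linr : forall x, A x -> linear_on B (m x);
  tens_dot : forall x x' y y', A x -> A x' -> B y -> B y' ->
    dot (m x y) (m x' y') = dot x x' * dot y y';
  tens_total :
    closure (lin [set z | exists x y, [/\ A x, B y & z = m x y]]) = setT }.

Definition op_tensor (H K T : hilbertType R) (m : H -> K -> T)
    (S1 : bop H) (S2 : bop K) (X : bop T) : Prop :=
  forall x y, X (m x y) = m (S1 x) (S2 y).

Definition spatial_tensor (H K T : hilbertType R) (m : H -> K -> T)
    (C1 : set (bop H)) (C2 : set (bop K)) : set (bop T) :=
  closure (lin [set X | exists S1 S2, [/\ C1 S1, C2 S2 & op_tensor m S1 S2 X]]).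

(* F restricts to the map f (x) g on the spatial tensor product of C1 and C2,
   i.e. to the bounded linear map taking S1 (x) S2 to f S1 (x) g S2; the
   relation r y1 y2 y expresses that y = y1 (x) y2 in the target space. *)
Record tensor_map (H K T : hilbertType R) (m : H -> K -> T)
    (C1 : set (bop H)) (C2 : set (bop K)) (Y1 Y2 : Type)
    (Y : normedModType R[i]) (r : Y1 -> Y2 -> Y -> Prop)
    (f : bop H -> Y1) (g : bop K -> Y2) (F : bop T -> Y) : Prop := TensorMap {
  tmap_linear : linear_on (spatial_tensor m C1 C2) F;
  tmap_bounded : exists M : R,
    forall X, spatial_tensor m C1 C2 X -> rnorm (F X) <= M * rnorm X;
  tmap_tensor : forall S1 S2 X, C1 S1 -> C2 S2 -> op_tensor m S1 S2 X ->
    r (f S1) (g S2) (F X) }.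

End Tensor.

(* os_C is a concrete operator space in B(os_H).  The maps on spatial tensor
   products required to exist by os_coassoc, os_counitr and os_counitl are, in
   this order, Delta (x) id, id (x) Delta, id (x) eps and eps (x) id. *)
Record os_coalgebra (R : realType) := OSCoalgebra {
  os_H : hilbertType R;
  (* os_H (x) os_H and os_H (x) os_H (x) os_H *)
  os_H2 : hilbertType R;
  os_H3 : hilbertType R;
  os_m2 : os_H -> os_H -> os_H2;
  os_ml : os_H2 -> os_H -> os_H3;
  os_mr : os_H -> os_H2 -> os_H3;
  os_m2P : hilbert_tensor setT setT os_m2;
  os_mlP : hilbert_tensor setT setT os_ml;
  os_mrP : hilbert_tensor setT setT os_mr;
  os_mA : forall x y z, os_ml (os_m2 x y) z = os_mr x (os_m2 y z);
  os_C : set (bop os_H);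
  os_C_sub : forall (a : R[i]) x y, os_C x -> os_C y -> os_C (a *: x + y);
  os_C0 : os_C 0;
  os_C_closed : closed os_C;
  os_Delta : bop os_H -> bop os_H2;
  os_eps : bop os_H -> R[i]^o;
  os_Delta_linear : linear_on os_C os_Delta;
  os_eps_linear : linear_on os_C os_eps;
  os_Delta_in :
    forall a, os_C a -> spatial_tensor os_m2 os_C os_C (os_Delta a);
  os_Delta_cc :
    cb_le (@bop_mxnorm R os_H) (@bop_mxnorm R os_H2) os_C os_Delta 1;
  os_eps_cc : cb_le (@bop_mxnorm R os_H) (@scalar_mxnorm R) os_C os_eps 1;
  os_coassoc : exists Fl Fr : bop os_H2 -> bop os_H3,
    [/\ tensor_map os_m2 os_C os_C (op_tensor os_ml) os_Delta id Fl,
        tensor_map os_m2 os_C os_C (op_tensor os_mr) id os_Delta Fr &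
        forall a, os_C a -> Fl (os_Delta a) = Fr (os_Delta a)];
  os_counitr : exists F : bop os_H2 -> bop os_H,
    tensor_map os_m2 os_C os_C (fun S1 z Y => Y = z *: S1) id os_eps F /\
    forall a, os_C a -> F (os_Delta a) = a;
  os_counitl : exists F : bop os_H2 -> bop os_H,
    tensor_map os_m2 os_C os_C (fun z S2 Y => Y = z *: S2) os_eps id F /\
    forall a, os_C a -> F (os_Delta a) = a }.

Arguments os_C {R} o.
Arguments os_m2 {R} o.
Arguments os_Delta {R} o.
Arguments os_eps {R} o.

Section Functionals.
Context {R : realType} (C : os_coalgebra R).
Implicit Types psi : bop (os_H C) -> R[i]^o.

(* For bounded psi1 and psi2 there is exactly one such functional, up to its
   irrelevant values outside the spatial tensor product. *)
Definition functional_tensor psi1 psi2 : bop (os_H2 C) -> R[i]^o :=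
  xget (fun=> 0) [set F | tensor_map (os_m2 C) (os_C C) (os_C C)
    (fun z1 z2 z : R[i]^o => z = z1 * z2) psi1 psi2 F].

Definition convol psi1 psi2 : bop (os_H C) -> R[i]^o :=
  functional_tensor psi1 psi2 \o os_Delta C.

Definition bounded_functional psi : Prop :=
  exists M : R, forall a, os_C C a -> rnorm (psi a) <= M * rnorm a.

(* The norm of C^*; meaningful for bounded functionals only, as the sup of an
   unbounded set is 0. *)
Definition fnorm psi : R :=
  sup [set rnorm (psi a) | a in [set a | os_C C a /\ rnorm a <= 1]].

Definition conv_semigroup (lambda : R -> bop (os_H C) -> R[i]^o) : Prop :=
  [/\ forall t, 0 <= t -> linear_on (os_C C) (lambda t) /\ bounded_functional (lambda t),
      forall a, os_C C a -> lambda 0 a = os_eps C a &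
      forall s t a, 0 <= s -> 0 <= t -> os_C C a ->
        lambda (s + t) a = convol (lambda s) (lambda t) a].

Definition norm_cts_at0 (lambda : R -> bop (os_H C) -> R[i]^o) : Prop :=
  fnorm (fun a => lambda t a - os_eps C a) @[t --> 0^'+] --> (0 : R).

Definition completely_bounded (H : hilbertType R)
    (phi : bop (os_H C) -> bop H) : Prop :=
  linear_on (os_C C) phi /\
  exists M : R, cb_le (@bop_mxnorm R (os_H C)) (@bop_mxnorm R H) (os_C C) phi M.

End Functionals.
Arguments norm_cts_at0 {R C} lambda.

Section ComplexAnalysis.
Context {R : realType}.

Definition cexp (z : R[i]) : R[i] :=
  (expR (complex.Re z))%:C * (cos (complex.Im z) +i* sin (complex.Im z)).

Definition cintegrable (D : set R) (f : R -> R[i]) : Prop :=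
  (@lebesgue_measure R).-integrable D (EFin \o (@complex.Re R \o f)) /\
  (@lebesgue_measure R).-integrable D (EFin \o (@complex.Im R \o f)).

Definition cintegral (D : set R) (f : R -> R[i]) : R[i] :=
  (\int[@lebesgue_measure R]_(s in D) complex.Re (f s)) +i*
  (\int[@lebesgue_measure R]_(s in D) complex.Im (f s)).

End ComplexAnalysis.

Section FockSpace.
Context {R : realType}.

Definition halfline : set R := `[0, +oo[.

(* f_J; also used for vectors c, as restr J (fun=> c). *)
Definition restr (k : hilbertType R) (J : set R) (f : R -> k) : R -> k :=
  patch (fun=> 0) J f.

(* On R_+: a pointwise limit of simple functions. *)
Definition strongly_measurable (k : hilbertType R) (f : R -> k) : Prop :=
  exists s : nat -> R -> k,
    (forall n, lin [set h | exists A d, measurable A /\ h = restr A (fun=> d)] (s n)) /\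
    (forall x, halfline x -> s n x @[n --> \oo] --> f x).

Definition sqintegrable (k : hilbertType R) (f : R -> k) : Prop :=
  strongly_measurable f /\
  (@lebesgue_measure R).-integrable halfline (fun s => (rnorm (f s) ^+ 2)%:E).

(* L^2(R_+; k): the square-integrable functions modulo null functions, with
   L2_class the quotient map. *)
Record L2_space (k : hilbertType R) := L2Space {
  L2_sort :> hilbertType R;
  L2_class : (R -> k) -> L2_sort;
  L2_linear : linear_on (@sqintegrable k) L2_class;
  L2_dot : forall f g, sqintegrable f -> sqintegrable g ->
    dot (L2_class f) (L2_class g) = cintegral halfline (fun s => dot (f s) (g s));
  L2_surj : forall x, exists2 f, sqintegrable f & L2_class f = x }.

(* The symmetric Fock space over L, the Hilbert space direct sum over n of the
   n-fold symmetric tensor powers of L; fock_pow n x is the tensor power of x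
   in the n-th summand, and these powers are total in that summand. *)
Record fock_space (L : hilbertType R) := FockSpace {
  fock_sort :> hilbertType R;
  fock_pow : nat -> L -> fock_sort;
  fock_dot : forall m n x y,
    dot (fock_pow m x) (fock_pow n y) = (m == n)%:R * dot x y ^+ n;
  fock_total : closure (lin [set u | exists n x, u = fock_pow n x]) = setT }.

Definition expvec (L : hilbertType R) (F : fock_space L) (x : L) : F :=
  limn (series (fun n => ((Num.sqrt (n`!%:R : R))^-1)%:C *: fock_pow F n x)).

End FockSpace.

Section Processes.
Context {R : realType} (C : os_coalgebra R) (k : hilbertType R)
  (L : L2_space k) (F : fock_space L).
Implicit Types (f g : R -> k) (l : R -> bop (os_H C) -> F -> F).

Definition step_fun : set (R -> k) :=
  lin [set f | exists d s, 0 <= s /\ f = restr `[0, s[ (fun=> d)].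

Definition ev f : F := expvec F (L2_class L f).

Definition exp_domain : set F := lin (ev @` step_fun).

(* The subspace F_J of F = F_[0,oo[. *)
Definition fock_on (J : set R) : set F :=
  closure (lin [set ev f | f in
    [set f | sqintegrable f /\ forall s, ~ J s -> f s = 0]]).

(* m is the factorization of F as F_[0,t[ (x) F_[t,oo[. *)
Definition fock_factorization (t : R) (m : F -> F -> F) : Prop :=
  hilbert_tensor (fock_on `[0, t[) (fock_on `[t, +oo[) m /\
  forall f, sqintegrable f ->
    m (ev (restr `[0, t[ f)) (ev (restr `[t, +oo[ f)) = ev f.

(* T is the operator X (x) I, for some operator X in F_[0,t[ with domain
   the span of the ev (restr `[0, t[ f). *)
Definition adapted_op (t : R) (T : F -> F) : Prop :=
  exists (m : F -> F -> F) (X : F -> F),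
    let E_t := lin [set ev (restr `[0, t[ f) | f in step_fun] in
    [/\ fock_factorization t m,
        linear_on E_t X,
        forall u, E_t u -> fock_on `[0, t[ (X u) &
        forall f, step_fun f ->
          T (ev f) = m (X (ev (restr `[0, t[ f))) (ev (restr `[t, +oo[ f))].

Record process l : Prop := Process {
  proc_op : forall t a, 0 <= t -> os_C C a -> linear_on exp_domain (l t a);
  proc_linear : forall t u, 0 <= t -> exp_domain u -> linear_on (os_C C) (l t ^~ u);
  proc_meas : forall a u v, os_C C a -> exp_domain u ->
    measurable_fun halfline (fun t => complex.Re (dot v (l t a u))) /\
    measurable_fun halfline (fun t => complex.Im (dot v (l t a u)));
  proc_adapted : forall t a, 0 <= t -> os_C C a -> adapted_op t (l t a) }.

Definition weakly_bounded l : Prop :=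
  forall t f g, 0 <= t -> step_fun f -> step_fun g ->
    bounded_functional (fun a => dot (ev f) (l t a (ev g))).

Definition hat (c : k) : khat k := (1, c).

(* The integrability of the integrand is part of the equation. *)
Definition weak_solution (phi : bop (os_H C) -> bop (khat k)) l : Prop :=
  [/\ process l, weakly_bounded l &
      forall f g t a, step_fun f -> step_fun g -> 0 <= t -> os_C C a ->
        let integrand s :=
          convol (fun b => dot (ev f) (l s b (ev g)))
               (fun b => dot (hat (f s)) (phi b (hat (g s)))) a in
        cintegrable `[0, t] integrand /\
        dot (ev f) (l t a (ev g) - os_eps C a *: ev g)
          = cintegral `[0, t] integrand].

Definition assoc_functional l (c d : k) (t : R) (a : bop (os_H C)) : R[i]^o :=
  cexp (- (t%:C * dot c d)) *
  dot (ev (restr `[0, t[ (fun=> c))) (l t a (ev (restr `[0, t[ (fun=> d)))).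

(* Functions are extended by 0 to the negative half-line; the discontinuity this
   may create at 0 is harmless as tau 0 = 0. *)
Definition weak_cocycle l : Prop :=
  [/\ process l, weakly_bounded l,
      forall a u, os_C C a -> exp_domain u -> l 0 a u = os_eps C a *: u &
      forall f g t a n (tau : nat -> R),
        step_fun f -> step_fun g -> 0 <= t -> os_C C a ->
        tau 0 = 0 -> tau n = t -> (forall i, (i < n)%N -> tau i <= tau i.+1) ->
        let ft := restr `[0, t[ f in let gt := restr `[0, t[ g in
        (forall s, ~ {for s, continuous ft} \/ ~ {for s, continuous gt} ->
           exists2 i, (i <= n)%N & tau i = s) ->
        cexp (- dot (L2_class L ft) (L2_class L gt)) *
          dot (ev ft) (l t a (ev gt))
        = (\big[@convol R C / os_eps C]_(i < n)
             assoc_functional l (f (tau i)) (g (tau i)) (tau i.+1 - tau i)) a].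

End Processes.

(* Main.v *)
Require Import Defs.
From mathcomp Require Import all_boot all_order all_algebra.
From mathcomp Require Import complex ring lra.
From mathcomp Require Import all_classical all_reals all_analysis.
From mathcomp Require Import measurable_realfun.

(* Write mu_s(a) = <e(f), l_s(a) e(g)>.  For a bounded functional chi on C let
   P_chi = (id (x) chi) Delta, a bounded operator on C; then the equation reads
   mu_t(a) = mu_0(a) + int_0^t mu_s(P_(chi_s) a) ds with chi_s piecewise constant.
   By the uniform boundedness principle mu_s is bounded uniformly for s in
   compact intervals, so on an interval [al, be[ where f = c and g = d are constant
   Taylor's formula gives mu_(al+s)(a) = sum_j s^j/j! mu_al(P^j a) with P = P_chi.
   In particular the associated functional lambda_s is eps o exp(sP).
   Coassociativity says that right slices P commute with left slices
   (omega (x) id) Delta, and an operator E on C commuting with the left slices is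
   P_(eps o E); hence exp(sP) = P_(lambda_s) and mu_(al+s) = mu_al * lambda_s, which
   gives the cocycle identity.  That l_0 = eps I follows from adaptedness, since
   the Fock space of the empty interval is spanned by the vacuum. *)

Set Implicit Arguments. Unset Strict Implicit. Unset Printing Implicit Defensive.
Import Order.TTheory GRing.Theory Num.Theory.
Import numFieldNormedType.Exports.
Local Open Scope classical_set_scope.
Local Open Scope ring_scope.
Local Open Scope complex_scope.

(** * Norms, subspaces and inner products *)

Section RNorm.
Context {R : realType}.

(** For a merely bounded [chi], the map id (x) chi has to be made: it is prescribed by matrix
    elements and carried from elementary tensors to the spatial tensor product by norm limits.
    Coassociativity can be read off the triple tensor product for vector functionals; duality
    extends it to bounded [chi]. Weak boundedness bounds mu_t at each single t, while a Taylor
    remainder needs one bound on a whole interval. The equation bounds s -> mu_s(a) for each fixed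
    a, and C is closed in the complete space B(H), so uniform boundedness joins the two. The
    operator exp(sP) enters only through its partial sums E. These are polynomials in P, so E =
    P_(eps o E) holds exactly, and both sides of mu_(al+s) = mu_al * lambda_s applied to a differ
    from mu_al(E a) by an error of the order of (Ks)^n/n!. At time 0 the equation controls only
    pairings with exponential vectors. Adaptedness makes l_0(a)e(f) a multiple of e(f), and the
    pairing with e(f) itself then fixes the scalar. *)

Lemma rnormN (V : normedZmodType R[i]) (x : V) : rnorm (- x) = rnorm x.
Proof. by rewrite /rnorm normrN. Qed.

Lemma rnormBC (V : normedZmodType R[i]) (x y : V) : rnorm (x - y) = rnorm (y - x).
Proof. by rewrite -rnormN opprB. Qed.

Lemma rnorm_tri (V : normedZmodType R[i]) (y x z : V) :
  rnorm (x - z) <= rnorm (x - y) + rnorm (y - z).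
Proof. by rewrite -(subrKA y) rnormD. Qed.

Lemma rnormM (x y : R[i]) : rnorm (x * y : R[i]^o) = rnorm (x : R[i]^o) * rnorm (y : R[i]^o).
Proof. exact: (@rnormZ R R[i]^o x y). Qed.

Lemma rnorm1 : rnorm (1 : R[i]^o) = 1 :> R.
Proof. by rewrite /rnorm normr1. Qed.

Lemma rnormC (r : R) : rnorm (r%:C : R[i]^o) = `|r|.
Proof. by rewrite /rnorm normc_def /= expr0n addr0 sqrtr_sqr. Qed.

Lemma rnormX (x : R[i]) n : rnorm (x ^+ n : R[i]^o) = rnorm (x : R[i]^o) ^+ n.
Proof. by elim: n => [|n IH]; rewrite ?rnorm1// !exprS rnormM IH. Qed.

Lemma complexCM (x y : R) : (x * y)%:C = x%:C * y%:C.
Proof. exact: rmorphM. Qed.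

Lemma complexCB (x y : R) : (x - y)%:C = x%:C - y%:C.
Proof. exact: rmorphB. Qed.

Lemma complexCX (x : R) n : (x ^+ n)%:C = x%:C ^+ n.
Proof. exact: rmorphXn. Qed.

Lemma rnorm_conj2 (x : R[i]) : `|conjc x : R[i]^o| ^+ 2 = x * conjc x.
Proof. by rewrite sqr_normc conjcK mulrC. Qed.

Lemma Re_le_rnorm (z : R[i]) : `|complex.Re z| <= rnorm (z : R[i]^o).
Proof. by have := normc_ge_Re z; rewrite (@rnormE R R[i]^o) lecR. Qed.

Lemma Im_le_rnorm (z : R[i]) : `|complex.Im z| <= rnorm (z : R[i]^o).
Proof.
rewrite /rnorm normc_def /= -[leLHS]sqrtr_sqr ler_wsqrtr// lerDr sqr_ge0 //.
Qed.

Lemma rnorm_le_ReIm (z : R[i]) : rnorm (z : R[i]^o) <= `|complex.Re z| + `|complex.Im z|.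
Proof.
rewrite /rnorm normc_def /= -[leRHS]ger0_norm ?addr_ge0// -sqrtr_sqr ler_wsqrtr//.
by rewrite sqrrD !real_normK ?num_real// addrAC lerDl mulrn_wge0// mulr_ge0.
Qed.

Lemma gt0_complexE (e : R[i]) : 0 < e -> e = (complex.Re e)%:C /\ 0 < complex.Re e.
Proof. by case: e => a b; rewrite ltcE /= => /andP[/eqP ->]. Qed.

Lemma ballrE (V : normedModType R[i]) (x y : V) (e : R) :
  ball x e%:C y <-> rnorm (x - y) < e.
Proof. by rewrite -ball_normE /= rnormE ltcR. Qed.

Lemma closure_rnormP (V : normedModType R[i]) (A : set V) (x : V) :
  closure A x <-> forall e : R, 0 < e -> exists2 y, A y & rnorm (x - y) < e.
Proof.
split=> [cx e e0|h].
  have [|y [Ay xy]] := cx (ball x e%:C); first by apply: nbhsx_ballx; rewrite ltcR.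
  by exists y => //; apply/ballrE.
move=> B /nbhs_ballP[e /= e0 eB].
have [eE er0] := gt0_complexE e0; have [y Ay xy] := h _ er0.
by exists y; split => //; apply: eB; rewrite eE; apply/ballrE.
Qed.

Lemma cvg_rnormP (V : normedModType R[i]) (u : nat -> V) (x : V) :
  u @ \oo --> x <-> (fun n => rnorm (x - u n)) @ \oo --> (0 : R).
Proof.
split=> [/cvgrPdist_lt h|/cvgrPdist_lt h]; apply/cvgrPdist_lt => e e0.
  have := h e%:C; rewrite ltcR => /(_ e0); apply: filterS => n.
  by rewrite rnormE ltcR sub0r normrN ger0_norm ?rnorm_ge0.
have [eE er0] := gt0_complexE e0; have := h _ er0; apply: filterS => n.
by rewrite rnormE eE ltcR sub0r normrN ger0_norm ?rnorm_ge0.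
Qed.

Lemma le_of_eps (x y : R) (K : R) : 0 <= K ->
  (forall e : R, 0 < e -> x <= y + K * e) -> x <= y.
Proof.
move=> K0 h; apply/ler_addgt0Pr => e e0.
have K1 : 0 < K + 1 by rewrite ltr_wpDl.
apply: le_trans (h (e / (K + 1)) _) _; first by rewrite divr_gt0.
by rewrite lerD2l mulrCA ger_pMr// ler_pdivrMr// mul1r lerDl.
Qed.

(** A rate symmetric in [n] and [m] needs no assumption on their order. Letting [m] tend to infinity
    leaves [e n], so the limit comes with an explicit error. *)
Lemma rnorm_complete (V : completeNormedModType R[i]) (u : nat -> V) (e : nat -> R) :
  e @ \oo --> (0 : R) -> (forall n m, rnorm (u n - u m) <= e n + e m) ->
  exists x, u @ \oo --> x /\ forall n, rnorm (u n - x) <= e n.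
Proof.
move=> e0 hu.
have cu : cauchy (u @ \oo).
  apply/cauchyP => d d0.
  have [dE dr0] := gt0_complexE d0.
  have r0 : 0 < complex.Re d / 2 by rewrite divr_gt0.
  have /cvgrPdist_lt/(_ _ r0)[N _ hN] := e0.
  exists (u N); rewrite dE; exists N => //= n Nn.
  apply/ballrE; apply: (le_lt_trans (hu _ _)).
  have := hN n Nn; have := hN N (leqnn N); rewrite /= !sub0r !normrN => h1 h2.
  by rewrite [ltRHS]splitr ltrD// (le_lt_trans (ler_norm _)).
have /cauchy_cvg/cvg_ex[x ux] := cu.
exists x; split => // n; apply: (@le_of_eps _ _ 2) => // d d0.
move: ux => /cvg_rnormP/cvgrPdist_lt/(_ _ d0)[N1 _ h1].
have /cvgrPdist_lt/(_ _ d0)[N2 _ h2] := e0.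
pose m := maxn N1 N2.
apply: le_trans (rnorm_tri (u m) _ _) _; rewrite (rnormBC (u m)).
have := h1 m (leq_maxl _ _); have := h2 m (leq_maxr _ _).
rewrite /= !sub0r !normrN (ger0_norm (rnorm_ge0 _)) => em xm.
by have := hu n m; have := ler_norm (e m); clear - em xm; lra.
Qed.

End RNorm.

Section LinearOn.
Context {R : realType}.
Implicit Types U V : lmodType R[i].

Definition subspace U (A : set U) : Prop :=
  A 0 /\ forall (a : R[i]) x y, A x -> A y -> A (a *: x + y).

Lemma subspaceT U : subspace [set: U]. Proof. by []. Qed.

Section Subspace.
Variables (U : lmodType R[i]) (A : set U).
Hypothesis sA : subspace A.

Lemma subspaceD x y : A x -> A y -> A (x + y).
Proof. by move=> Ax Ay; rewrite -[x]scale1r; apply: sA.2. Qed.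

Lemma subspaceZ (a : R[i]) x : A x -> A (a *: x).
Proof. by move=> Ax; rewrite -[a *: x]addr0; apply: sA.2 => //; exact: sA.1. Qed.

Lemma subspaceB x y : A x -> A y -> A (x - y).
Proof.
by move=> Ax Ay; rewrite addrC -scaleN1r; exact: sA.2.
Qed.

Lemma subspace_sum I (r : seq I) (P : pred I) (F : I -> U) :
  (forall i, A (F i)) -> A (\sum_(i <- r | P i) F i).
Proof.
by move=> h; elim/big_ind: _ => //; [exact: sA.1|exact: subspaceD].
Qed.

Variables (V : lmodType R[i]) (f : U -> V).
Hypothesis lf : linear_on A f.

Lemma linear_on0 : f 0 = 0.
Proof.
have := lf (-1) sA.1 sA.1; rewrite scaleN1r addNr => h.
by rewrite {1}h scaleN1r addNr.
Qed.

Lemma linear_onD x y : A x -> A y -> f (x + y) = f x + f y.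
Proof. by move=> Ax Ay; rewrite -[x]scale1r lf// !scale1r. Qed.

Lemma linear_onZ (a : R[i]) x : A x -> f (a *: x) = a *: f x.
Proof. by move=> Ax; rewrite -[a *: x]addr0 lf ?linear_on0 ?addr0//; exact: sA.1. Qed.

Lemma linear_onB x y : A x -> A y -> f (x - y) = f x - f y.
Proof. by move=> Ax Ay; rewrite addrC -scaleN1r lf// scaleN1r addrC. Qed.

Lemma linear_on_sum I (r : seq I) (P : pred I) (F : I -> U) :
  (forall i, A (F i)) ->
  f (\sum_(i <- r | P i) F i) = \sum_(i <- r | P i) f (F i).
Proof.
move=> h; elim: r => [|i r IH]; first by rewrite !big_nil linear_on0.
rewrite !big_cons; case: ifP => // Pi.
by rewrite linear_onD ?IH//; exact: subspace_sum.
Qed.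

End Subspace.

Lemma lin_sub U (A : set U) x : A x -> lin A x.
Proof.
move=> Ax; exists 1%N, (fun=> 1), (fun=> x); split=> //.
by rewrite big_ord1 scale1r.
Qed.

Lemma lin_subspace U (A : set U) : subspace (lin A).
Proof.
split; first by exists 0%N, (fun=> 0), (fun=> 0); split=> [[]//|]; rewrite big_ord0.
move=> c x y [n [a [v [Av ->]]]] [m [b [w [Aw ->]]]].
exists (n + m)%N,
  (fun i : 'I_(n + m) =>
     match fintype.split i with inl j => c * a j | inr j => b j end),
  (fun i : 'I_(n + m) =>
     match fintype.split i with inl j => v j | inr j => w j end); split.
  by move=> i; case: (fintype.split i).
rewrite big_split_ord /= scaler_sumr; congr (_ + _); apply: eq_bigr => i _.
  by rewrite (unsplitK (inl _ i)) scalerA.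
by rewrite (unsplitK (inr _ i)).
Qed.

Lemma lin_ind U (A D : set U) : subspace D -> A `<=` D -> lin A `<=` D.
Proof.
move=> sD AD x [n [a [v [Av ->]]]]; apply: subspace_sum => // i.
by apply: subspaceZ => //; exact: AD.
Qed.

Lemma closure_subspace (V : normedModType R[i]) (A : set V) :
  subspace A -> subspace (closure A).
Proof.
move=> sA; split; first by apply: subset_closure; exact: sA.1.
move=> a x y /closure_rnormP cx /closure_rnormP cy.
apply/closure_rnormP => e e0.
have a1 : 0 < rnorm (a : R[i]^o) + 1 by rewrite ltr_wpDl// rnorm_ge0.
have [|x' Ax' xx'] := cx (e / 2 / (rnorm (a : R[i]^o) + 1)).
  by rewrite !divr_gt0.
have [|y' Ay' yy'] := cy (e / 2); first by rewrite divr_gt0.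
exists (a *: x' + y'); first exact: sA.2.
rewrite opprD addrACA -scalerBr; apply: le_lt_trans (rnormD _ _) _.
rewrite rnormZ [ltRHS]splitr ler_ltD//.
move: xx'; rewrite ltr_pdivlMr// mulrC => /ltW; apply: le_trans.
by rewrite ler_wpM2r ?rnorm_ge0// lerDl.
Qed.

End LinearOn.

Section Dot.
Context {R : realType} {H : hilbertType R}.
Implicit Types x y z : H.

Lemma dot_lin x : linear_on setT (dot x : H -> R[i]^o).
Proof. by move=> a y z _ _; exact: dotPr. Qed.

Lemma dot0r x : dot x 0 = 0.
Proof. exact: (linear_on0 (@subspaceT _ _) (@dot_lin x)). Qed.

Lemma dotDr x y z : dot x (y + z) = dot x y + dot x z.
Proof. exact: (linear_onD (@dot_lin x)). Qed.

Lemma dotBr x y z : dot x (y - z) = dot x y - dot x z.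
Proof. exact: (linear_onB (@dot_lin x)). Qed.

Lemma dotZr (a : R[i]) x y : dot x (a *: y) = a * dot x y.
Proof. exact: (linear_onZ (@subspaceT _ _) (@dot_lin x)). Qed.

Lemma dot_sumr x I (r : seq I) (P : pred I) (F : I -> H) :
  dot x (\sum_(i <- r | P i) F i) = \sum_(i <- r | P i) dot x (F i).
Proof. exact: (linear_on_sum (@subspaceT _ _) (@dot_lin x)). Qed.

Lemma dot0l x : dot 0 x = 0.
Proof. by rewrite dotC dot0r rmorph0. Qed.

Lemma dotBl x y z : dot (y - z) x = dot y x - dot z x.
Proof. by rewrite dotC dotBr rmorphB /= -!dotC. Qed.

Lemma dotZl (a : R[i]) x y : dot (a *: y) x = conjc a * dot y x.
Proof. by rewrite dotC dotZr rmorphM /= -dotC. Qed.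

Lemma dot_suml x I (r : seq I) (P : pred I) (F : I -> H) :
  dot (\sum_(i <- r | P i) F i) x = \sum_(i <- r | P i) dot (F i) x.
Proof. by rewrite dotC dot_sumr rmorph_sum; apply: eq_bigr => i _; rewrite /= -dotC. Qed.

Lemma dotxxE x : dot x x = (rnorm x ^+ 2)%:C.
Proof. by rewrite dotxx rnormE rmorphXn. Qed.

Lemma Cauchy_Schwarz x y : rnorm (dot x y : R[i]^o) <= rnorm x * rnorm y.
Proof.
have [y0|yn0] := eqVneq (rnorm y) 0.
  by rewrite (rnorm_eq0 y0) dot0r !rnorm0 mulr0.
have yp : 0 < rnorm y by rewrite lt_def yn0 rnorm_ge0.
(* The vector [n *: x - b *: y] is [n] times the component of [x] orthogonal to [y]; the factor [n]
   avoids a division. *)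
pose n := (rnorm y ^+ 2)%:C; pose b := dot y x.
have : 0 <= rnorm (n *: x - b *: y) ^+ 2 by rewrite sqr_ge0.
have nn : conjc n = n by rewrite /n conjc_real.
have : (rnorm (n *: x - b *: y) ^+ 2)%:C =
    (rnorm y ^+ 2 * (rnorm x ^+ 2 * rnorm y ^+ 2 - rnorm (dot x y : R[i]^o) ^+ 2))%:C.
  have hb : (rnorm (conjc b : R[i]^o) ^+ 2)%:C = b * conjc b.
    by rewrite rmorphXn /= -(@rnormE R R[i]^o) rnorm_conj2.
  rewrite -dotxxE !dotBr !dotBl !dotZr !dotZl !dotxxE -/n -/b. rewrite nn (dotC y x) -/b.
  rewrite complexCM complexCB complexCM hb -/n.
  ring.
move=> /complexI ->; rewrite pmulr_rge0 ?exprn_gt0// subr_ge0 -exprMn.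
by rewrite ler_pXn2r ?nnegrE ?mulr_ge0 ?rnorm_ge0.
Qed.

Lemma dot_ext x y : (forall z, dot z x = dot z y) -> x = y.
Proof.
move=> h; apply/eqP; rewrite -subr_eq0; apply/eqP/rnorm_eq0/eqP.
by rewrite -sqrf_eq0 -(inj_eq (@complexI R)) -dotxxE dotBr h subrr.
Qed.

Lemma rnorm_le_dot x (M : R) : 0 <= M ->
  (forall y, rnorm (dot y x : R[i]^o) <= M * rnorm y) -> rnorm x <= M.
Proof.
move=> M0 h; have [->//|xn0] := eqVneq (rnorm x) 0.
have xp : 0 < rnorm x by rewrite lt_def xn0 rnorm_ge0.
have := h x; rewrite dotxxE rnormC ger0_norm ?sqr_ge0// expr2.
by rewrite ler_pM2r.
Qed.

End Dot.

(** * Completeness of B(H) *)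

Section BopComplete.
Context {R : realType} {H : hilbertType R}.

Lemma bopB (S T : bop H) x : (S - T) x = S x - T x.
Proof. by rewrite bopD -scaleN1r bopZ scaleN1r. Qed.

Lemma rnorm_bop (T : bop H) x : rnorm (T x) <= rnorm T * rnorm x.
Proof. exact: opnorm_bound. Qed.

Lemma rnorm_bop_le_dot (T : bop H) (M : R) : 0 <= M ->
  (forall x y, rnorm (dot x (T y) : R[i]^o) <= M * rnorm x * rnorm y) ->
  rnorm T <= M.
Proof.
move=> M0 h; apply: opnorm_le => // y; apply: rnorm_le_dot => [|x].
  by rewrite mulr_ge0 ?rnorm_ge0.
by rewrite mulrAC.
Qed.

Lemma bop_dot_ext (S T : bop H) :
  (forall x y, dot x (S y) = dot x (T y)) -> S = T.
Proof. by move=> h; apply: bopP => y; apply: dot_ext => x. Qed.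

(** The pointwise limits are reached at rate [e n * rnorm x], uniformly on the unit ball; hence the
    limit is a bounded operator and is approached in operator norm. *)
Lemma bop_complete (u : nat -> bop H) (e : nat -> R) :
  e @ \oo --> (0 : R) -> (forall n m, rnorm (u n - u m) <= e n + e m) ->
  exists T, forall n, rnorm (u n - T) <= e n.
Proof.
move=> e0 hu.
have ex x : exists y, u ^~ x @ \oo --> y /\ forall n, rnorm (u n x - y) <= e n * rnorm x.
  apply: rnorm_complete => [|n m].
    by rewrite -[X in _ --> X](mul0r (rnorm x)); apply: cvgMl.
  by rewrite -bopB -mulrDl; apply: le_trans (rnorm_bop _ _) _; rewrite ler_wpM2r ?rnorm_ge0.
pose T x := xget 0 [set y | u ^~ x @ \oo --> y /\ forall n, rnorm (u n x - y) <= e n * rnorm x].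
have hT x : u ^~ x @ \oo --> T x /\ forall n, rnorm (u n x - T x) <= e n * rnorm x.
  by rewrite /T; case: xgetP => [y -> //|]; have [y hy] := ex x => /(_ y).
have Tlin : linear T.
  move=> a x y; apply: (cvg_unique (@norm_hausdorff _ _) (hT _).1).
  have -> : u ^~ (a *: x + y) = (fun n => a *: u n x + u n y).
    by apply/funext => n; exact: linearP.
  apply: cvgD; last exact: (hT y).1.
  apply: cvgZl_tmp; exact: (hT x).1.
have Tb : exists M : R, forall x, rnorm (T x) <= M * rnorm x.
  exists (e 0%N + rnorm (u 0%N)) => x; rewrite -[T x](subrK (u 0%N x)) mulrDl.
  apply: le_trans (rnormD _ _) _; rewrite lerD ?rnorm_bop// rnormBC.
  exact: (hT x).2.
exists (Bop Tlin Tb) => n; apply: opnorm_le => [|x]; last by rewrite bopB; exact: (hT x).2.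
(* A rate is nonnegative: for [m = n] the Cauchy estimate reads 0 <= e n + e n. *)
by have := hu n n; rewrite subrr rnorm0 -mulr2n pmulrn_lge0.
Qed.

Lemma closed_limit (A : set (bop H)) (T : bop H) : closed A ->
  (forall e : R, 0 < e -> exists2 S, A S & rnorm (T - S) < e) -> A T.
Proof. by move=> cA h; apply: cA; apply/closure_rnormP. Qed.

End BopComplete.

(** * Slice maps on spatial tensor products *)

Section BoundedOn.
Context {R : realType}.

Definition bounded_on (V : normedModType R[i]) (A : set V) (W : normedModType R[i])
    (f : V -> W) : Prop :=
  linear_on A f /\ exists2 M : R, 0 <= M & forall x, A x -> rnorm (f x) <= M * rnorm x.

Lemma bounded_onI (V W : normedModType R[i]) (A : set V) (f : V -> W) :
  linear_on A f -> (exists M : R, forall x, A x -> rnorm (f x) <= M * rnorm x) ->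
  bounded_on A f.
Proof.
move=> lf [M hM]; split=> //; exists (Num.max 0 M); first by rewrite le_max lexx.
move=> x Ax; apply: (le_trans (hM x Ax)); rewrite ler_wpM2r ?rnorm_ge0//.
by rewrite le_max lexx orbT.
Qed.

Lemma bounded_on_comp (U V W : normedModType R[i]) (A : set U) (B : set V)
    (f : V -> W) (g : U -> V) : (forall x, A x -> B (g x)) ->
  bounded_on B f -> bounded_on A g -> bounded_on A (f \o g).
Proof.
move=> AB [lf [M M0 hM]] [lg [N N0 hN]]; split.
  by move=> a x y Ax Ay /=; rewrite lg// lf//; exact: AB.
exists (M * N); rewrite ?mulr_ge0// => x Ax /=.
by apply: le_trans (hM _ (AB _ Ax)) _; rewrite -mulrA ler_wpM2l ?hN.
Qed.

Lemma rnorm_eps_eq (V : normedModType R[i]) (x y : V) (K : R) : 0 <= K ->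
  (forall e : R, 0 < e -> rnorm (x - y) <= K * e) -> x = y.
Proof.
move=> K0 h; apply/eqP; rewrite -subr_eq0; apply/eqP/rnorm_eq0/le_anti.
rewrite rnorm_ge0 andbT; apply: (@le_of_eps _ _ _ K) => // e e0.
by rewrite add0r h.
Qed.

Lemma bounded_on_dot (H : hilbertType R) (A : set (bop H)) (x y : H) :
  bounded_on A (fun S : bop H => dot x (S y) : R[i]^o).
Proof.
split=> [a S T _ _|]; first by rewrite bopD bopZ dotDr dotZr.
exists (rnorm x * rnorm y); first by rewrite mulr_ge0 ?rnorm_ge0.
move=> S _; apply: le_trans (Cauchy_Schwarz _ _) _; rewrite -mulrA ler_wpM2l ?rnorm_ge0//.
by rewrite mulrC rnorm_bop.
Qed.

Lemma bounded_on_dot_comp (V : normedModType R[i]) (A : set V) (H : hilbertType R)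
    (g : V -> bop H) (x y : H) :
  bounded_on A g -> bounded_on A (fun v => dot x (g v y) : R[i]^o).
Proof.
move=> bg; apply: (bounded_on_comp (B := setT)
  (f := fun S : bop H => dot x (S y) : R[i]^o) _ _ bg) => //.
exact: bounded_on_dot.
Qed.

End BoundedOn.

Section Slices.
Context {R : realType} {H K T : hilbertType R} (m : H -> K -> T).
Context (C1 : set (bop H)) (C2 : set (bop K)).
Hypothesis mP : hilbert_tensor setT setT m.
Hypothesis sC1 : subspace C1.
Hypothesis sC2 : subspace C2.
Hypothesis cC1 : closed C1.
Hypothesis cC2 : closed C2.

Local Notation sp := (spatial_tensor m C1 C2).

Lemma spatial_closed (X : bop T) :
  (forall e : R, 0 < e -> exists2 Y, sp Y & rnorm (X - Y) < e) -> sp X.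
Proof. by apply: closed_limit; exact: closed_closure. Qed.

Lemma spatial_subspace : subspace sp.
Proof. exact/closure_subspace/lin_subspace. Qed.

Lemma spatial_elem S1 S2 X : C1 S1 -> C2 S2 -> op_tensor m S1 S2 X -> sp X.
Proof.
by move=> h1 h2 hX; apply/subset_closure/lin_sub; exists S1, S2.
Qed.

Lemma spatial_ind (D : set (bop T)) : subspace D ->
  (forall S1 S2 X, C1 S1 -> C2 S2 -> op_tensor m S1 S2 X -> D X) ->
  (forall X, (forall e : R, 0 < e -> exists2 Y, D Y & rnorm (X - Y) < e) -> D X) ->
  sp `<=` D.
Proof.
move=> sD eD cD X /closure_rnormP hX; apply: cD => e e0.
have [Y lY XY] := hX e e0; exists Y => //; apply: lin_ind lY => //.
by move=> Z [S1 [S2 [h1 h2 h3]]]; exact: (eD S1 S2).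
Qed.

Lemma spatial_ext (W : normedModType R[i]) (F G : bop T -> W) :
  bounded_on sp F -> bounded_on sp G ->
  (forall S1 S2 X, C1 S1 -> C2 S2 -> op_tensor m S1 S2 X -> F X = G X) ->
  forall X, sp X -> F X = G X.
Proof.
move=> [lF [M M0 hM]] [lG [N N0 hN]] FG X spX.
(* The set of agreement is cut down to the spatial tensor product, since [F] and [G] are linear and
   bounded only there. *)
suff : (sp `&` [set X | F X = G X]) X by case.
have sS := spatial_subspace.
apply: spatial_ind spX => [|S1 S2 Z h1 h2 hZ|Z hZ].
- split; first by split; [exact: sS.1|rewrite /= !(linear_on0 sS)].
  by move=> a x y [sx /= xE] [sy /= yE]; split; [exact: sS.2|rewrite /= lF// lG// xE yE].
- by split; [exact: spatial_elem h1 h2 hZ|exact: FG h1 h2 hZ].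
- have sZ : sp Z.
    by apply: spatial_closed => e /hZ[Y [sY _] ZY]; exists Y.
  split=> //=; apply: (@rnorm_eps_eq _ _ _ _ (M + N)); first by rewrite addr_ge0.
  move=> e /hZ[Y [sY /= FGY] /ltW ZY].
  rewrite -(subrKA (F Y)) {2}FGY -(linear_onB lF)// -(linear_onB lG)//.
  apply: le_trans (rnormD _ _) _; rewrite mulrDl lerD//.
    by apply: le_trans (hM _ _) _; [exact: (subspaceB sS)|rewrite ler_wpM2l].
  apply: le_trans (hN _ _) _; [exact: (subspaceB sS)|rewrite rnormBC ler_wpM2l//].
Qed.

(** All slice maps come from here. The [X] whose form [B x y X] is represented by an operator in [C]
    make up a subspace containing the elementary tensors. It is closed under norm limits: the bound
    on [B] gives [rnorm Y <= M * rnorm X], so approximating [X] makes the representing operators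
    Cauchy. Taking limits inside the closed space [C] is what places the result in [C]. *)
Lemma slice_ex (G : hilbertType R) (C : set (bop G)) (B : G -> G -> bop T -> R[i]^o) (M : R) :
  subspace C -> closed C -> 0 <= M ->
  (forall x y, linear_on sp (B x y)) ->
  (forall x y X, sp X -> rnorm (B x y X) <= M * rnorm X * rnorm x * rnorm y) ->
  (forall S1 S2 X, C1 S1 -> C2 S2 -> op_tensor m S1 S2 X ->
    exists2 Y, C Y & forall x y, dot x (Y y) = B x y X) ->
  forall X, sp X -> exists2 Y, C Y & forall x y, dot x (Y y) = B x y X.
Proof.
move=> sC cC M0 lB bB eB X spX.
have sS := spatial_subspace.
suff : (sp `&` [set X | exists2 Y, C Y & forall x y, dot x (Y y) = B x y X]) X.
  by case.
apply: spatial_ind spX => {X} [|S1 S2 Z h1 h2 hZ|Z hZ].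
- split; first split; first exact: sS.1.
    exists 0 => [|x y]; first exact: sC.1.
    by rewrite (linear_on0 sS (lB x y)) dot0r.
  move=> a X1 X2 [s1 [Y1 c1 e1]] [s2 [Y2 c2 e2]]; split; first exact: sS.2.
  exists (a *: Y1 + Y2) => [|x y]; first exact: sC.2.
  by rewrite lB// -e1 -e2 bopD bopZ dotDr dotZr.
- by split; [exact: spatial_elem h1 h2 hZ|exact: eB h1 h2 hZ].
have sZ : sp Z.
  by apply: spatial_closed => e /hZ[Y [sY _] ZY]; exists Y.
split=> //=.
have hn (n : nat) : exists XY : bop T * bop G,
    [/\ sp XY.1, C XY.2, rnorm (Z - XY.1) < n.+1%:R^-1 &
     forall x y, dot x (XY.2 y) = B x y XY.1].
  have [|X [sX [Y cY YE]] ZX] := hZ n.+1%:R^-1; first by rewrite invr_gt0.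
  by exists (X, Y).
have [f hf] := choice hn.
have bnd (S : bop G) (X : bop T) : sp X -> (forall x y, dot x (S y) = B x y X) ->
    rnorm S <= M * rnorm X.
  move=> sX hS; apply: rnorm_bop_le_dot => [|x y]; first by rewrite mulr_ge0 ?rnorm_ge0.
  by rewrite hS; exact: bB.
pose e (n : nat) : R := M * n.+1%:R^-1.
have e0 : e @ \oo --> (0 : R).
  by rewrite -[X in _ --> X](mulr0 M); apply: cvgMr; exact: cvg_harmonic.
have [n n'|Y hY] := bop_complete (u := fun n => (f n).2) e0.
  have [s1 c1 z1 E1] := hf n; have [s2 c2 z2 E2] := hf n'.
  apply: le_trans (bnd _ ((f n).1 - (f n').1) _ _) _; first exact: (subspaceB sS).
    by move=> x y; rewrite bopB dotBr E1 E2 (linear_onB (lB x y)).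
  rewrite /e -mulrDr ler_wpM2l//; apply: le_trans (rnorm_tri Z _ _) _.
  by rewrite lerD ?(ltW z2)// rnormBC ltW.
have lim0 (d : R) : 0 < d -> exists2 n, e n < d & (n.+1%:R^-1 : R) < d.
  move=> d0; have /cvgrPdist_lt/(_ _ d0)[N1 _ h1] := e0.
  have /cvgrPdist_lt/(_ _ d0)[N2 _ h2] := @cvg_harmonic R.
  exists (maxn N1 N2).
    by have := h1 _ (leq_maxl N1 N2); rewrite /= sub0r normrN; apply: le_lt_trans (ler_norm _).
  by have := h2 _ (leq_maxr N1 N2); rewrite /= sub0r normrN; apply: le_lt_trans (ler_norm _).
exists Y.
  apply: closed_limit cC _ => d d0; have [n en _] := lim0 d d0.
  have [s1 c1 z1 E1] := hf n; exists (f n).2 => //.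
  by rewrite rnormBC; apply: le_lt_trans (hY n) _.
move=> x y; apply: (@rnorm_eps_eq _ R[i]^o _ _ (rnorm x * rnorm y + M * rnorm x * rnorm y)).
  by rewrite addr_ge0 ?mulr_ge0 ?rnorm_ge0.
move=> d d0; have [n /ltW en /ltW nd] := lim0 d d0.
have [s1 c1 z1 E1] := hf n.
rewrite -(subrKA (B x y (f n).1)) -{1}E1 -dotBr -bopB -(linear_onB (lB x y))//.
apply: le_trans (rnormD _ _) _; rewrite mulrDl lerD//.
  apply: le_trans (Cauchy_Schwarz _ _) _; rewrite -mulrA ler_wpM2l ?rnorm_ge0//.
  apply: le_trans (rnorm_bop _ _) _; rewrite mulrC ler_wpM2l ?rnorm_ge0//.
  by rewrite rnormBC (le_trans (hY n)).
apply: le_trans (bB _ _ _ _) _; first exact: (subspaceB sS).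
rewrite -!mulrA ler_wpM2l// mulrC -!mulrA ler_wpM2l ?rnorm_ge0// ler_wpM2l ?rnorm_ge0//.
by rewrite rnormBC (le_trans (ltW z1)).
Qed.

Lemma rnorm_tens x y : rnorm (m x y) = rnorm x * rnorm y.
Proof.
apply/eqP; rewrite -(@eqrXn2 _ 2)// ?mulr_ge0 ?rnorm_ge0//.
rewrite -(inj_eq (@complexI R)) -dotxxE (tens_dot mP)// !dotxxE -complexCM.
by rewrite exprMn.
Qed.

(** This is (omega_(xi,eta) (x) id)(X). The default 0 can be met only for [X] outside the spatial
    tensor product. *)
Definition vec_slice (xi eta : H) (X : bop T) : bop K :=
  xget 0 [set Y | C2 Y /\ forall x y, dot x (Y y) = dot (m xi x) (X (m eta y))].

Lemma bounded_on_tens xi eta x y :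
  bounded_on sp (fun X : bop T => dot (m xi x) (X (m eta y)) : R[i]^o).
Proof. exact: bounded_on_dot. Qed.

Lemma vec_sliceP xi eta X : sp X -> C2 (vec_slice xi eta X) /\
  forall x y, dot x (vec_slice xi eta X y) = dot (m xi x) (X (m eta y)).
Proof.
move=> sX; suff [Y cY YE] : exists2 Y, C2 Y &
    forall x y, dot x (Y y) = (dot (m xi x) (X (m eta y)) : R[i]^o).
  by rewrite /vec_slice; case: xgetP => [Z -> //|]; move=> /(_ Y) [].
apply: (slice_ex (B := fun x y X => dot (m xi x) (X (m eta y)) : R[i]^o)
  (M := rnorm xi * rnorm eta) sC2 cC2 _ _ _ _ sX) => {X sX}.
- by rewrite mulr_ge0 ?rnorm_ge0.
- by move=> x y; exact: (bounded_on_tens _ _ _ _).1.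
- move=> x y X sX; apply: le_trans (Cauchy_Schwarz _ _) _.
  have -> : rnorm xi * rnorm eta * rnorm X * rnorm x * rnorm y =
    (rnorm xi * rnorm x) * (rnorm X * (rnorm eta * rnorm y)) by ring.
  by rewrite -!rnorm_tens ler_wpM2l ?rnorm_ge0//; exact: rnorm_bop.
- move=> S1 S2 X h1 h2 hX; exists (dot xi (S1 eta) *: S2).
    exact: (subspaceZ sC2).
  by move=> x y; rewrite bopZ dotZr hX (tens_dot mP).
Qed.

Lemma vec_slice_in xi eta X : sp X -> C2 (vec_slice xi eta X).
Proof. by case/(vec_sliceP xi eta). Qed.

Lemma vec_sliceE xi eta X x y : sp X ->
  dot x (vec_slice xi eta X y) = dot (m xi x) (X (m eta y)).
Proof. by move=> sX; have [_ ->] := vec_sliceP xi eta sX. Qed.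

Lemma rnorm_vec_slice xi eta X : sp X ->
  rnorm (vec_slice xi eta X) <= rnorm xi * rnorm eta * rnorm X.
Proof.
move=> sX; apply: rnorm_bop_le_dot => [|x y]; first by rewrite !mulr_ge0 ?rnorm_ge0.
rewrite vec_sliceE//; apply: le_trans (Cauchy_Schwarz _ _) _.
have -> : rnorm xi * rnorm eta * rnorm X * rnorm x * rnorm y =
  (rnorm xi * rnorm x) * (rnorm X * (rnorm eta * rnorm y)) by ring.
rewrite -!rnorm_tens ler_wpM2l ?rnorm_ge0//; exact: rnorm_bop.
Qed.

Lemma bounded_vec_slice xi eta : bounded_on sp (vec_slice xi eta).
Proof.
split=> [a X Y sX sY|].
  apply: bop_dot_ext => x y; rewrite bopD bopZ dotDr dotZr !vec_sliceE//.
    by rewrite bopD bopZ dotDr dotZr.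
  exact: spatial_subspace.2.
by exists (rnorm xi * rnorm eta); rewrite ?mulr_ge0 ?rnorm_ge0//; exact: rnorm_vec_slice.
Qed.

Lemma vec_slice_elem xi eta S1 S2 X : C1 S1 -> C2 S2 -> op_tensor m S1 S2 X ->
  vec_slice xi eta X = dot xi (S1 eta) *: S2.
Proof.
move=> h1 h2 hX; apply: bop_dot_ext => x y.
rewrite vec_sliceE; last exact: spatial_elem h1 h2 hX.
by rewrite hX (tens_dot mP)// bopZ dotZr.
Qed.

(** This is (id (x) chi)(X): slicing by [chi] is interchanged with slicing by the vector functional
    of [x] and [y], which is already available. *)
Definition right_slice (chi : bop K -> R[i]^o) (X : bop T) : bop H :=
  xget 0 [set Y | C1 Y /\ forall x y, dot x (Y y) = chi (vec_slice x y X)].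

Section RightSlice.
Variable chi : bop K -> R[i]^o.
Hypothesis bchi : bounded_on C2 chi.

Lemma right_sliceP X : sp X -> C1 (right_slice chi X) /\
  forall x y, dot x (right_slice chi X y) = chi (vec_slice x y X).
Proof.
move=> sX; suff [Y cY YE] : exists2 Y, C1 Y &
    forall x y, dot x (Y y) = chi (vec_slice x y X).
  by rewrite /right_slice; case: xgetP => [Z -> //|]; move=> /(_ Y) [].
have [lchi [M M0 hM]] := bchi.
apply: (slice_ex (B := fun x y X => chi (vec_slice x y X)) sC1 cC1 M0 _ _ _ sX)
  => {X sX}.
- move=> x y; apply: (bounded_on_comp _ bchi (bounded_vec_slice x y)).1.
  exact: vec_slice_in.
- move=> x y X sX; apply: le_trans (hM _ (vec_slice_in _ _ sX)) _.
  rewrite -!mulrA ler_wpM2l//; apply: le_trans (rnorm_vec_slice _ _ sX) _.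
  by rewrite mulrC.
- move=> S1 S2 X h1 h2 hX; exists (chi S2 *: S1).
    exact: (subspaceZ sC1).
  move=> x y; rewrite bopZ dotZr (vec_slice_elem x y h1 h2 hX).
  by rewrite (linear_onZ sC2 lchi)// mulrC.
Qed.

Lemma right_slice_in X : sp X -> C1 (right_slice chi X).
Proof. by case/right_sliceP. Qed.

Lemma right_sliceE X x y : sp X ->
  dot x (right_slice chi X y) = chi (vec_slice x y X).
Proof. by move=> sX; have [_ ->] := right_sliceP sX. Qed.

Lemma rnorm_right_slice (M : R) X : 0 <= M ->
  (forall S, C2 S -> rnorm (chi S) <= M * rnorm S) -> sp X ->
  rnorm (right_slice chi X) <= M * rnorm X.
Proof.
move=> M0 hM sX; apply: rnorm_bop_le_dot => [|x y]; first by rewrite mulr_ge0 ?rnorm_ge0.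
rewrite right_sliceE//; apply: le_trans (hM _ (vec_slice_in _ _ sX)) _.
rewrite -!mulrA ler_wpM2l//; apply: le_trans (rnorm_vec_slice _ _ sX) _.
by rewrite mulrC.
Qed.

Lemma bounded_right_slice : bounded_on sp (right_slice chi).
Proof.
have [lchi [M M0 hM]] := bchi; split=> [a X Y sX sY|].
  apply: bop_dot_ext => x y; rewrite bopD bopZ dotDr dotZr !right_sliceE//.
    rewrite (bounded_vec_slice x y).1// lchi//; exact: vec_slice_in.
  exact: spatial_subspace.2.
by exists M => // X; exact: rnorm_right_slice.
Qed.

Lemma right_slice_elem S1 S2 X : C1 S1 -> C2 S2 -> op_tensor m S1 S2 X ->
  right_slice chi X = chi S2 *: S1.
Proof.
move=> h1 h2 hX; apply: bop_dot_ext => x y.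
rewrite right_sliceE; last exact: spatial_elem h1 h2 hX.
by rewrite (vec_slice_elem x y h1 h2 hX) (linear_onZ sC2 bchi.1)// bopZ dotZr mulrC.
Qed.

End RightSlice.

Lemma dot_right_slice X xi eta x y : sp X ->
  dot xi (right_slice (fun S => dot x (S y)) X eta) = dot (m xi x) (X (m eta y)).
Proof.
move=> sX; rewrite right_sliceE//; last exact: bounded_on_dot.
exact: vec_sliceE.
Qed.

(** This is (rho (x) id)(X). Going through right slices by vector functionals spares a copy of the
    construction with the two factors exchanged. *)
Definition left_slice (rho : bop H -> R[i]^o) (X : bop T) : bop K :=
  xget 0 [set Y | C2 Y /\
    forall x y, dot x (Y y) = rho (right_slice (fun S => dot x (S y)) X)].

Section LeftSlice.
Variable rho : bop H -> R[i]^o.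
Hypothesis brho : bounded_on C1 rho.

Let rslice_in x y X : sp X -> C1 (right_slice (fun S => dot x (S y)) X).
Proof. by apply: right_slice_in; exact: bounded_on_dot. Qed.

Let rnorm_rslice x y X : sp X ->
  rnorm (right_slice (fun S => dot x (S y)) X) <= rnorm x * rnorm y * rnorm X.
Proof.
apply: rnorm_right_slice; first exact: bounded_on_dot.
  by rewrite mulr_ge0 ?rnorm_ge0.
move=> S _; apply: le_trans (Cauchy_Schwarz _ _) _; rewrite -mulrA ler_wpM2l ?rnorm_ge0//.
by rewrite mulrC rnorm_bop.
Qed.

Lemma left_sliceP X : sp X -> C2 (left_slice rho X) /\
  forall x y, dot x (left_slice rho X y) = rho (right_slice (fun S => dot x (S y)) X).
Proof.
move=> sX; suff [Y cY YE] : exists2 Y, C2 Y &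
    forall x y, dot x (Y y) = rho (right_slice (fun S => dot x (S y)) X).
  by rewrite /left_slice; case: xgetP => [Z -> //|]; move=> /(_ Y) [].
have [lrho [M M0 hM]] := brho.
apply: (slice_ex (B := fun x y X => rho (right_slice (fun S => dot x (S y)) X))
  sC2 cC2 M0 _ _ _ sX) => {X sX}.
- move=> x y; apply: (bounded_on_comp _ brho (bounded_right_slice _)).1.
    exact: rslice_in.
  exact: bounded_on_dot.
- move=> x y X sX; apply: le_trans (hM _ (rslice_in _ _ sX)) _.
  rewrite -!mulrA ler_wpM2l//; apply: le_trans (rnorm_rslice _ _ sX) _.
  by rewrite mulrC.
- move=> S1 S2 X h1 h2 hX; exists (rho S1 *: S2).
    exact: (subspaceZ sC2).
  move=> x y; rewrite (right_slice_elem _ h1 h2 hX); last exact: bounded_on_dot.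
  by rewrite bopZ dotZr (linear_onZ sC1 lrho)// mulrC.
Qed.

Lemma left_slice_in X : sp X -> C2 (left_slice rho X).
Proof. by case/left_sliceP. Qed.

Lemma left_sliceE X x y : sp X ->
  dot x (left_slice rho X y) = rho (right_slice (fun S => dot x (S y)) X).
Proof. by move=> sX; have [_ ->] := left_sliceP sX. Qed.

Lemma bounded_left_slice : bounded_on sp (left_slice rho).
Proof.
have [lrho [M M0 hM]] := brho; split=> [a X Y sX sY|].
  apply: bop_dot_ext => x y; rewrite bopD bopZ dotDr dotZr !left_sliceE//.
    have bs := @bounded_right_slice _ (bounded_on_dot C2 x y).
    rewrite bs.1// lrho//; exact: rslice_in.
  exact: spatial_subspace.2.
exists M => // X sX; apply: rnorm_bop_le_dot => [|x y].
  by rewrite mulr_ge0 ?rnorm_ge0.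
rewrite left_sliceE//; apply: le_trans (hM _ (rslice_in _ _ sX)) _.
rewrite -!mulrA ler_wpM2l//; apply: le_trans (rnorm_rslice _ _ sX) _.
by rewrite mulrC.
Qed.

Lemma left_slice_elem S1 S2 X : C1 S1 -> C2 S2 -> op_tensor m S1 S2 X ->
  left_slice rho X = rho S1 *: S2.
Proof.
move=> h1 h2 hX; apply: bop_dot_ext => x y.
rewrite left_sliceE; last exact: spatial_elem h1 h2 hX.
rewrite (right_slice_elem _ h1 h2 hX); last exact: bounded_on_dot.
by rewrite (linear_onZ sC1 brho.1)// bopZ dotZr mulrC.
Qed.

End LeftSlice.

Lemma dot_left_slice X xi eta x y : sp X ->
  dot x (left_slice (fun S => dot xi (S eta)) X y) = dot (m xi x) (X (m eta y)).
Proof.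
move=> sX; rewrite left_sliceE//; last exact: bounded_on_dot.
exact: dot_right_slice.
Qed.

(** Both sides are (rho (x) chi)(X): they are bounded in [X] and equal rho(S1) chi(S2) on elementary
    tensors. *)
Lemma slices_commute (rho : bop H -> R[i]^o) (chi : bop K -> R[i]^o) X :
  bounded_on C1 rho -> bounded_on C2 chi -> sp X ->
  rho (right_slice chi X) = chi (left_slice rho X).
Proof.
move=> brho bchi; move: X; apply: spatial_ext.
- apply: (bounded_on_comp _ brho (bounded_right_slice bchi)).
  exact: right_slice_in.
- apply: (bounded_on_comp _ bchi (bounded_left_slice brho)).
  exact: left_slice_in.
- move=> S1 S2 X h1 h2 hX.
  rewrite (right_slice_elem bchi h1 h2 hX) (left_slice_elem brho h1 h2 hX).
  by rewrite (linear_onZ sC1 brho.1)// (linear_onZ sC2 bchi.1)//; exact: mulrC.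
Qed.

(** This provides the functional whose existence the choice in [functional_tensor] relies on. *)
Lemma tensor_map_slice (rho : bop H -> R[i]^o) (chi : bop K -> R[i]^o) :
  bounded_on C1 rho -> bounded_on C2 chi ->
  tensor_map m C1 C2 (fun z1 z2 z : R[i]^o => z = z1 * z2) rho chi
    (fun X => rho (right_slice chi X)).
Proof.
move=> brho bchi.
have [lF [M M0 hM]] := bounded_on_comp (right_slice_in bchi) brho (bounded_right_slice bchi).
split=> //; first by exists M.
move=> S1 S2 X h1 h2 hX.
by rewrite (right_slice_elem bchi h1 h2 hX) (linear_onZ sC1 brho.1)// mulrC.
Qed.

Lemma bounded_tensor_map (Y1 Y2 : Type) (Y : normedModType R[i]) r f g (F : bop T -> Y) :
  @tensor_map R H K T m C1 C2 Y1 Y2 Y r f g F -> bounded_on sp F.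
Proof. by move=> hF; apply: bounded_onI; [exact: tmap_linear hF|exact: tmap_bounded hF]. Qed.

End Slices.

(** * Convolution on an operator space coalgebra *)

Section MatrixNorm1.
Context {R : realType}.

Lemma mxopnorm1 (V : normedModType R[i]) (T : 'I_1 -> 'I_1 -> V -> V) :
  mxopnorm T = sup [set rnorm (T ord0 ord0 x) | x in [set x | rnorm x <= 1]].
Proof.
congr sup; apply/seteqP; split=> [_ [x /= + <-]|_ [x /= + <-]].
  rewrite big_ord1 -[leRHS](expr1n _ 2) ler_pXn2r ?nnegrE ?rnorm_ge0// => x1.
  by exists (x ord0) => //; rewrite !big_ord1 sqrtr_sqr ger0_norm ?rnorm_ge0.
move=> x1; exists (fun=> x); rewrite /= !big_ord1 ?sqrtr_sqr ?ger0_norm ?rnorm_ge0//.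
by rewrite -[1](expr1n _ 2) ler_pXn2r ?nnegrE ?rnorm_ge0.
Qed.

Lemma bop_mxnorm1 (V : normedModType R[i]) (A : 'M[bop V]_1) :
  bop_mxnorm A = rnorm (A ord0 ord0).
Proof. exact: mxopnorm1. Qed.

Lemma rnorm_le_scalar_mxnorm1 (A : 'M[R[i]^o]_1) :
  rnorm (A ord0 ord0) <= scalar_mxnorm A.
Proof.
rewrite /scalar_mxnorm mxopnorm1; apply: ub_le_sup.
  exists (rnorm (A ord0 ord0)) => _ [x /= x1 <-].
  by rewrite rnormM -[leRHS]mulr1 ler_wpM2l ?rnorm_ge0.
by exists 1; rewrite /= ?rnorm1// mulr1.
Qed.

Lemma cb_le_bop1 (H K : normedModType R[i]) (A : set (bop H)) (f : bop H -> bop K) (M : R) :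
  cb_le (@bop_mxnorm R H) (@bop_mxnorm R K) A f M ->
  forall a, A a -> rnorm (f a) <= M * rnorm a.
Proof.
move=> h a Aa; have := h 1%N (const_mx a); rewrite !bop_mxnorm1 !mxE; apply.
by move=> i j; rewrite mxE.
Qed.

End MatrixNorm1.

Section Convolution.
Context {R : realType} (C : os_coalgebra R).
Local Notation CC := (os_C C).
Local Notation m2 := (os_m2 C).
Local Notation Delta := (os_Delta C).
Local Notation eps := (os_eps C).
Local Notation sp := (spatial_tensor m2 CC CC).
Local Notation bfun := (@bounded_on R _ CC R[i]^o).
Implicit Types (psi chi rho : bop (os_H C) -> R[i]^o) (a : bop (os_H C)).

Lemma os_subspace : subspace CC.
Proof. by split; [exact: os_C0|exact: os_C_sub]. Qed.

Let sC := os_subspace.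
Let cC : closed CC := os_C_closed (o := C).
Let mP : hilbert_tensor setT setT m2 := os_m2P C.

Lemma rnorm_Delta a : CC a -> rnorm (Delta a) <= rnorm a.
Proof. by move=> Ca; rewrite -[leRHS]mul1r; apply: (cb_le_bop1 (os_Delta_cc (o := C))). Qed.

Lemma bounded_Delta : bounded_on CC Delta.
Proof.
split; first exact: os_Delta_linear.
by exists 1 => // a /rnorm_Delta; rewrite mul1r.
Qed.

Lemma bounded_eps : bfun eps.
Proof.
split; first exact: os_eps_linear.
exists 1 => // a Ca.
have := os_eps_cc (o := C) (n := 1) (a := const_mx a).
rewrite bop_mxnorm1 mxE => h; apply: le_trans (h _); last by move=> i j; rewrite mxE.
by apply: le_trans (rnorm_le_scalar_mxnorm1 _); rewrite !mxE.
Qed.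

Lemma bounded_vec (xi eta : os_H C) : bfun (fun S => dot xi (S eta)).
Proof. exact: bounded_on_dot. Qed.

(** [rconv chi] is the operator P_chi, and [lconv rho] is its left counterpart (rho (x) id)
    Delta. *)
Definition rconv chi a : bop (os_H C) := right_slice m2 CC CC chi (Delta a).
Definition lconv rho a : bop (os_H C) := left_slice m2 CC CC rho (Delta a).

Let Dsp a : CC a -> sp (Delta a) := @os_Delta_in R C a.

Lemma rconv_in chi a : bfun chi -> CC a -> CC (rconv chi a).
Proof. by move=> bchi Ca; apply: right_slice_in => //; exact: Dsp. Qed.

Lemma lconv_in rho a : bfun rho -> CC a -> CC (lconv rho a).
Proof. by move=> brho Ca; apply: left_slice_in => //; exact: Dsp. Qed.

Lemma bounded_rconv chi : bfun chi -> bounded_on CC (rconv chi).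
Proof.
move=> bchi; apply: (bounded_on_comp Dsp _ bounded_Delta).
exact: bounded_right_slice.
Qed.

Lemma bounded_lconv rho : bfun rho -> bounded_on CC (lconv rho).
Proof.
move=> brho; apply: (bounded_on_comp Dsp _ bounded_Delta).
exact: bounded_left_slice.
Qed.

Lemma rnorm_rconv chi (M : R) a : bfun chi -> 0 <= M ->
  (forall S, CC S -> rnorm (chi S) <= M * rnorm S) -> CC a ->
  rnorm (rconv chi a) <= M * rnorm a.
Proof.
move=> bchi M0 hM Ca.
apply: le_trans (rnorm_right_slice mP sC sC cC cC bchi M0 hM (Dsp Ca)) _.
by rewrite ler_wpM2l ?rnorm_Delta.
Qed.

Lemma rconv_lconv rho chi a : bfun rho -> bfun chi -> CC a ->
  rho (rconv chi a) = chi (lconv rho a).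
Proof. 
move=> brho bchi Ca; exact: (slices_commute mP sC sC cC cC brho bchi (Dsp Ca)). Qed.

(** The functional chosen in [convol] is determined on the spatial tensor product by boundedness and
    its values on elementary tensors, so it agrees there with psi o (id (x) chi). *)
Lemma convolE psi chi a : bfun psi -> bfun chi -> CC a ->
  convol psi chi a = psi (rconv chi a).
Proof.
move=> bpsi bchi Ca; have tm := tensor_map_slice mP sC sC cC cC bpsi bchi.
rewrite /convol /= /functional_tensor; case: xgetP => [F _ hF|]; last by move/(_ _ tm).
apply: (spatial_ext (bounded_tensor_map hF) (bounded_tensor_map tm)); last exact: Dsp.
move=> S1 S2 X h1 h2 hX; rewrite (tmap_tensor hF h1 h2 hX).
by rewrite (tmap_tensor tm h1 h2 hX).
Qed.

Lemma bounded_convol psi chi : bfun psi -> bfun chi -> bfun (convol psi chi).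
Proof.
move=> bpsi bchi.
have [l [M M0 hM]] := bounded_on_comp (fun a => @rconv_in chi a bchi) bpsi (bounded_rconv bchi).
split; last by exists M => // a Ca; rewrite convolE//; exact: hM.
by move=> c a b Ca Cb; rewrite !convolE//; [exact: l|exact: sC.2].
Qed.

Lemma rconv_eps a : CC a -> rconv eps a = a.
Proof.
move=> Ca; have [F [tF FD]] := os_counitr C; rewrite -[RHS]FD// /rconv.
apply: (spatial_ext _ (bounded_tensor_map tF)); last exact: Dsp.
  exact: (bounded_right_slice mP sC sC cC cC bounded_eps).
move=> S1 S2 X h1 h2 hX; rewrite (tmap_tensor tF h1 h2 hX).
exact: (right_slice_elem mP sC sC cC cC bounded_eps h1 h2 hX).
Qed.

Lemma lconv_eps a : CC a -> lconv eps a = a.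
Proof.
move=> Ca; have [F [tF FD]] := os_counitl C; rewrite -[RHS]FD// /lconv.
apply: (spatial_ext _ (bounded_tensor_map tF)); last exact: Dsp.
  exact: (bounded_left_slice mP sC sC cC cC bounded_eps).
move=> S1 S2 X h1 h2 hX; rewrite (tmap_tensor tF h1 h2 hX).
exact: (left_slice_elem mP sC sC cC cC bounded_eps h1 h2 hX).
Qed.

(** The left counit property. It recovers a functional from its convolution operator. *)
Lemma eps_rconv chi a : bfun chi -> CC a -> eps (rconv chi a) = chi a.
Proof. by move=> bchi Ca; rewrite rconv_lconv ?lconv_eps//; exact: bounded_eps. Qed.

Lemma eps_lconv rho a : bfun rho -> CC a -> eps (lconv rho a) = rho a.
Proof. by move=> brho Ca; rewrite -rconv_lconv ?rconv_eps//; exact: bounded_eps. Qed.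

Local Notation vec xi eta := (fun S : bop (os_H C) => dot xi (S eta) : R[i]^o).

(* For vector functionals both sides are matrix elements of (Delta (x) id) Delta
   and (id (x) Delta) Delta on simple tensors, so that no tensor products of
   operators on the triple product are needed. *)
Lemma coassoc_vec xi1 xi2 xi3 eta1 eta2 eta3 a : CC a ->
  dot (m2 xi1 xi2) (Delta (rconv (vec xi3 eta3) a) (m2 eta1 eta2)) =
  dot (m2 xi2 xi3) (Delta (lconv (vec xi1 eta1) a) (m2 eta2 eta3)).
Proof.
move=> Ca; have [Fl [Fr [tl tr FE]]] := os_coassoc C.
have El X : sp X ->
    (dot (os_ml (m2 xi1 xi2) xi3) (Fl X (os_ml (m2 eta1 eta2) eta3)) : R[i]^o) =
    dot (m2 xi1 xi2) (Delta (right_slice m2 CC CC (vec xi3 eta3) X) (m2 eta1 eta2)).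
  have b3 := bounded_vec xi3 eta3.
  move: X; apply: spatial_ext.
  - exact: (bounded_on_dot_comp _ _ (bounded_tensor_map tl)).
  - apply: bounded_on_dot_comp; apply: (bounded_on_comp (B := CC) (f := Delta)).
    + exact: right_slice_in.
    + exact: bounded_Delta.
    + exact: bounded_right_slice.
  - move=> S1 S2 X h1 h2 hX; rewrite (tmap_tensor tl h1 h2 hX).
    rewrite (tens_dot (os_mlP C))// (right_slice_elem mP sC sC cC cC b3 h1 h2 hX).
    rewrite (linear_onZ sC (os_Delta_linear (o := C)))// bopZ dotZr.
    exact: mulrC.
have Er X : sp X ->
    (dot (os_mr xi1 (m2 xi2 xi3)) (Fr X (os_mr eta1 (m2 eta2 eta3))) : R[i]^o) =
    dot (m2 xi2 xi3) (Delta (left_slice m2 CC CC (vec xi1 eta1) X) (m2 eta2 eta3)).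
  have b1 := bounded_vec xi1 eta1.
  move: X; apply: spatial_ext.
  - exact: (bounded_on_dot_comp _ _ (bounded_tensor_map tr)).
  - apply: bounded_on_dot_comp; apply: (bounded_on_comp (B := CC) (f := Delta)).
    + exact: left_slice_in.
    + exact: bounded_Delta.
    + exact: bounded_left_slice.
  - move=> S1 S2 X h1 h2 hX; rewrite (tmap_tensor tr h1 h2 hX).
    rewrite (tens_dot (os_mrP C))// (left_slice_elem mP sC sC cC cC b1 h1 h2 hX).
    by rewrite (linear_onZ sC (os_Delta_linear (o := C)))// bopZ dotZr.
rewrite /rconv /lconv -El; last exact: Dsp.
by rewrite -Er ?FE ?os_mA//; exact: Dsp.
Qed.

Lemma dot_rconv xi1 xi2 eta1 eta2 a : CC a ->
  dot xi1 (rconv (vec xi2 eta2) a eta1) = dot (m2 xi1 xi2) (Delta a (m2 eta1 eta2)).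
Proof. by move=> Ca; apply: dot_right_slice => //; exact: Dsp. Qed.

Lemma dot_lconv xi1 xi2 eta1 eta2 a : CC a ->
  dot xi2 (lconv (vec xi1 eta1) a eta2) = dot (m2 xi1 xi2) (Delta a (m2 eta1 eta2)).
Proof. by move=> Ca; apply: dot_left_slice => //; exact: Dsp. Qed.

Lemma lconv_rconv_vec xi1 eta1 xi3 eta3 a : CC a ->
  lconv (vec xi1 eta1) (rconv (vec xi3 eta3) a) =
  rconv (vec xi3 eta3) (lconv (vec xi1 eta1) a).
Proof.
move=> Ca; apply: bop_dot_ext => xi2 eta2.
rewrite dot_lconv; last by apply: rconv_in => //; exact: bounded_vec.
rewrite dot_rconv; last by apply: lconv_in => //; exact: bounded_vec.
exact: coassoc_vec.
Qed.

(** Duality carries the case of vector functionals to a general [chi]. A matrix element of the left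
    side is rho(P_chi a) = chi(lconv rho a) for the functional [rho] below. The operator lconv rho a
    no longer involves [chi], and its own matrix elements bring in vector functionals only. *)
Lemma lconv_rconv xi eta chi a : bfun chi -> CC a ->
  lconv (vec xi eta) (rconv chi a) = rconv chi (lconv (vec xi eta) a).
Proof.
move=> bchi Ca; have bv := bounded_vec.
apply: bop_dot_ext => xi2 eta2.
pose rho : bop (os_H C) -> R[i]^o := fun S => dot xi2 (lconv (vec xi eta) S eta2).
have brho : bfun rho.
  apply: (bounded_on_comp (f := vec xi2 eta2) _ _ (bounded_lconv (bv xi eta))) => [S|].
    exact: lconv_in.
  exact: bv.
have rhoE : lconv rho a = lconv (vec xi2 eta2) (lconv (vec xi eta) a).
  apply: bop_dot_ext => xi3 eta3.
  rewrite -[LHS](rconv_lconv brho (bv xi3 eta3) Ca) /rho lconv_rconv_vec//.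
  rewrite dot_rconv ?dot_lconv//; exact: lconv_in.
rewrite -[LHS]/(rho (rconv chi a)) (rconv_lconv brho bchi Ca) rhoE.
rewrite -(rconv_lconv (bv xi2 eta2) bchi)//; exact: lconv_in.
Qed.

(** Let omega be a vector functional and L = (omega (x) id) Delta. Then omega(P_(eps o E) a) =
    eps(E(L a)) = eps(L(E a)) = omega(E a), the last equality being a counit property. *)
Lemma rconv_of_commute (E : bop (os_H C) -> bop (os_H C)) a :
  bounded_on CC E -> (forall b, CC b -> CC (E b)) ->
  (forall xi eta b, CC b -> lconv (vec xi eta) (E b) = E (lconv (vec xi eta) b)) ->
  CC a -> rconv (eps \o E) a = E a.
Proof.
move=> bE EC cE Ca; have bv := bounded_vec.
have beE : bfun (eps \o E) := bounded_on_comp EC bounded_eps bE.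
apply: bop_dot_ext => xi eta.
rewrite (rconv_lconv (bv xi eta) beE Ca) /= -cE//.
by rewrite eps_lconv//; exact: EC.
Qed.

(** With omega and L as in the preceding lemma, omega(P_(psi * chi) a) = psi(P_chi(L a)) =
    psi(L(P_chi a)) = omega(P_psi(P_chi a)). *)
Lemma rconv_convol psi chi a : bfun psi -> bfun chi -> CC a ->
  rconv (convol psi chi) a = rconv psi (rconv chi a).
Proof.
move=> bpsi bchi Ca; have bv := bounded_vec.
apply: bop_dot_ext => xi eta.
have bc := bounded_convol bpsi bchi.
rewrite (rconv_lconv (bv xi eta) bc Ca) convolE//; last exact: lconv_in.
rewrite -lconv_rconv// -(rconv_lconv (bv xi eta) bpsi)//; exact: rconv_in.
Qed.

End Convolution.

(** * The uniform boundedness principle *)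

Section UniformBoundedness.
Context {R : realType} {H : hilbertType R} (A : set (bop H)).
Hypothesis sA : subspace A.
Hypothesis cA : closed A.
Context (I : Type) (T : I -> bop H -> R[i]^o).
Hypothesis bT : forall i, bounded_on A (T i).

Let N i : R := sup [set rnorm (T i a) | a in [set a | A a /\ rnorm a <= 1]].

Let hsN i : has_sup [set rnorm (T i a) | a in [set a | A a /\ rnorm a <= 1]].
Proof.
have [_ [M M0 hM]] := bT i.
split; first by exists (rnorm (T i 0)), 0 => //=; rewrite rnorm0; split => //; exact: sA.1.
exists M => _ [a [/= Aa a1] <-]; apply: (le_trans (hM a Aa)).
by rewrite -[leRHS]mulr1 ler_wpM2l.
Qed.

Let N_bound i a : A a -> rnorm (T i a) <= N i * rnorm a.
Proof.
move=> Aa; have lT := (bT i).1.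
have [x0|x0] := eqVneq (rnorm a) 0.
  by rewrite x0 mulr0 (rnorm_eq0 x0) (linear_on0 sA lT) rnorm0.
have xp : 0 < rnorm a by rewrite lt_def x0 rnorm_ge0.
have nV : rnorm ((rnorm a)^-1%:C : R[i]^o) = (rnorm a)^-1.
  by rewrite rnormC ger0_norm// invr_ge0 ltW.
rewrite -ler_pdivrMr// mulrC -nV -(@rnormZ R R[i]^o) -(linear_onZ sA lT)//.
apply: ub_le_sup; first exact: (hsN i).2.
exists ((rnorm a)^-1%:C *: a) => //=; split; first exact: subspaceZ.
by rewrite rnormZ nV mulVf.
Qed.

Let N_attained i : 0 < N i -> exists a, [/\ A a, rnorm a <= 1 & 2 / 3 * N i <= rnorm (T i a)].
Proof.
move=> N0; have e0 : 0 < N i / 3 by rewrite divr_gt0.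
have [_ [a [/= Aa a1] <-] h] := sup_adherent e0 (hsN i).
by exists a; split => //; apply: ltW; apply: le_lt_trans h; rewrite -/(N i); lra.
Qed.

(* The gliding hump: each step moves by 3^-n in the one of two opposite
   directions which does not decrease |T (i n)|. *)
Let hump (i : nat -> I) (a : nat -> bop H) := fix x (n : nat) : bop H :=
  if n is n'.+1 then
    let d := ((3 ^- n')%:C : R[i]) *: a n' in
    if 3 ^- n' * rnorm (T (i n') (a n')) <= rnorm (T (i n') (x n' + d))
    then x n' + d else x n' - d
  else 0.

(** If the norms [N i] were unbounded, the humps would converge to some [z], which lies in [A]
    because [A] is closed in a complete space, while T (i n) z has modulus at least n for every
    n. *)
Lemma uniform_boundedness :
  (forall a, A a -> exists B : R, forall i, rnorm (T i a) <= B) ->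
  exists2 M : R, 0 <= M & forall i a, A a -> rnorm (T i a) <= M * rnorm a.
Proof.
move=> pb; apply: contrapT => nb.
have Nunb M : 0 <= M -> exists i, M < N i.
  move=> M0; apply: contrapT => h; apply: nb; exists M => // i a Aa.
  apply: le_trans (N_bound i Aa) _; rewrite ler_wpM2r ?rnorm_ge0// leNgt.
  by apply/negP => Mi; apply: h; exists i.
(* The factor 6 is 1 / (2/3 - 1/2): step n makes |T (i n)| at least 2/3 * 3^-n * N (i n), and the
   later steps together take away at most 1/2 * 3^-n * N (i n). *)
have exi (n : nat) : exists i, 6 * 3 ^+ n * n%:R < N i.
  by apply: Nunb; rewrite !mulr_ge0// exprn_ge0.
have [i hi] := choice exi.
have N0 n : 0 < N (i n) by apply: le_lt_trans (hi n); rewrite !mulr_ge0// exprn_ge0.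
have [a ha] := choice (fun n => N_attained (N0 n)).
pose x := hump i a.
have p3 n : 0 < 3 ^- n :> R by rewrite invr_gt0 exprn_gt0.
have Ax n : A (x n).
  elim: n => [|n IH] /=; first exact: sA.1.
  have [Aa _ _] := ha n; have Ad := subspaceZ sA ((3 ^- n)%:C : R[i]) Aa.
  by case: ifP => _; [exact: subspaceD|exact: subspaceB].
have dx n : rnorm (x n.+1 - x n) <= 3 ^- n.
  have [Aa a1 _] := ha n.
  have nd : rnorm ((3 ^- n)%:C *: a n : bop H) <= 3 ^- n.
    by rewrite rnormZ rnormC ger0_norm ?(ltW (p3 n))// ger_pMr.
  rewrite /=; case: ifP => _; first by rewrite addrAC subrr add0r.
  by rewrite addrAC subrr add0r rnormN.
have big n : 2 / 3 * 3 ^- n * N (i n) <= rnorm (T (i n) (x n.+1)).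
  have [Aa a1 Ta] := ha n; have lT := (bT (i n)).1.
  have Ad := subspaceZ sA ((3 ^- n)%:C : R[i]) Aa.
  apply: (@le_trans _ _ (3 ^- n * rnorm (T (i n) (a n)))).
    by rewrite (mulrC (2 / 3)) -mulrA ler_wpM2l ?(ltW (p3 n)).
  rewrite /=; case: ifP => //; rewrite -/(x n) => /negbT; rewrite -ltNge => h.
  set d := _ *: _ in h *.
  have TdE : rnorm (T (i n) d) = 3 ^- n * rnorm (T (i n) (a n)).
    by rewrite (linear_onZ sA lT)// rnormZ rnormC ger0_norm ?(ltW (p3 n)).
  (* The values at x + d and x - d differ by 2 T(d), so they cannot both be smaller than T(d) in
     modulus. *)
  have : rnorm (T (i n) d + T (i n) d) <= rnorm (T (i n) (x n + d)) + rnorm (T (i n) (x n - d)).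
    rewrite -[rnorm (T (i n) (x n - d))]rnormN.
    apply: le_trans (rnormD _ _).
    rewrite (linear_onD lT)// (linear_onB lT)// opprB.
    by rewrite [X in _ <= rnorm X]addrC subrKA.
  have -> : T (i n) d + T (i n) d = (2%:R : R)%:C *: T (i n) d.
    by rewrite rmorph_nat scaler_nat.
  rewrite rnormZ rnormC normr_nat TdE.
  by move: h; rewrite -TdE; lra.
(* The tail of the geometric series: the sum of 3^-j over j >= n. *)
pose e n : R := 3 / 2 * 3 ^- n.
have eS n : e n = 3 ^- n + e n.+1.
  by rewrite /e exprS; field; rewrite expf_neq0.
have e0 : e @ \oo --> (0 : R).
  rewrite -[X in _ --> X](mulr0 (3 / 2)); apply: cvgMr.
  have -> : (fun n => 3 ^- n : R) = GRing.exp (3^-1) by apply/funext => n; rewrite exprVn.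
  by apply: cvg_expr; rewrite ger0_norm// invf_lt1// ltr1n.
have xle n k : rnorm (x (k + n)%N - x n) <= e n - e (k + n)%N.
  elim: k => [|k IH]; first by rewrite add0n !subrr rnorm0.
  apply: le_trans (rnorm_tri (x (k + n)%N) _ _) _; rewrite addSn.
  by have := dx (k + n)%N; have := eS (k + n)%N; lra.
have ep n : 0 <= e n by rewrite /e mulr_ge0// ltW.
have [n m|z hz] := bop_complete (u := x) e0.
  wlog nm : n m / (n <= m)%N.
    by move=> h; have [/h//|/ltnW/h] := leqP n m; rewrite rnormBC [e m + _]addrC.
  rewrite rnormBC; have := xle n (m - n)%N; rewrite subnK// => h.
  by apply: le_trans h _; have := ep m; lra.
have Az : A z.
  apply: closed_limit => // d d0.
  have /cvgrPdist_lt/(_ _ d0)[n _ hn] := e0.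
  exists (x n) => //; rewrite rnormBC; apply: le_lt_trans (hz n) _.
  by have := hn n (leqnn n); rewrite /= sub0r normrN ger0_norm.
have [B hB] := pb z Az.
have [n Bn] : exists n : nat, B < n%:R by exists (Num.truncn B).+1; exact: truncnS_gt.
suff : n%:R <= rnorm (T (i n) z) by move=> h; have := hB (i n); lra.
have h1 : rnorm (T (i n) (x n.+1)) <= rnorm (T (i n) z) + N (i n) * e n.+1.
  rewrite -[x n.+1](subrK z) addrC (linear_onD (bT (i n)).1)//; last exact: subspaceB.
  apply: le_trans (rnormD _ _) _; rewrite lerD2l.
  apply: le_trans (N_bound _ _) _; first exact: subspaceB.
  by rewrite ler_wpM2l// ltW.
have h2 := big n.
have h4 : e n.+1 = 1 / 2 * 3 ^- n.
  by rewrite /e exprS; field; rewrite expf_neq0.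
have h3 : 6 * n%:R < N (i n) * 3 ^- n.
  by rewrite ltr_pdivlMr ?exprn_gt0// mulrAC.
by rewrite h4 in h1; move: h1 h2 h3; set p := 3 ^- n; set y := N (i n); lra.
Qed.

End UniformBoundedness.

(** * Taylor expansion and the complex exponential *)

Section Taylor.
Context {R : realType}.
Local Notation mu := (@lebesgue_measure R).

Lemma integral_derive (G g : R -> R) (a b : R) :
  (forall x, is_derive x (1 : R) G (g x)) -> continuous g -> a <= b ->
  mu.-integrable `[a, b] (EFin \o g) /\ \int[mu]_(x in `[a, b]) g x = G b - G a.
Proof.
move=> dG cg ab; split.
  apply: continuous_compact_integrable; first exact: segment_compact.
  exact: continuous_subspaceT.
move: ab; rewrite le_eqVlt => /predU1P[<-|ab].
  by rewrite set_itv1 Rintegral_set1 subrr.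
have cG x : {for x, continuous G}.
  by apply/differentiable_continuous/derivable1_diffP; case: (dG x).
rewrite /Rintegral (@continuous_FTC2 _ g G)//.
- exact: continuous_subspaceT.
- split=> [x _||]; first by case: (dG x).
  + exact/cvg_at_right_filter/cG.
  + exact/cvg_at_left_filter/cG.
- by move=> x _; rewrite derive1E; case: (dG x).
Qed.

Definition tpow (al : R) j (r : R) : R := (r - al) ^+ j / j`!%:R.

Lemma is_derive_tpow al j x : is_derive x (1 : R) (tpow al j.+1) (tpow al j x).
Proof.
have -> : tpow al j.+1 = (j.+1`!%:R)^-1 \*: ((fun r => r - al) ^+ j.+1).
  by apply/funext => r; rewrite /tpow /= fctE mulrC.
apply: is_derive_eq; rewrite /tpow /= factS natrM invfM subr0 /= scaler1.
rewrite -[_ *: _]/(_ * _) mulrCA mulrA mulrAC mulrA -[X in X * _]mulrA.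
by congr (_ / _); rewrite mulrCA mulfV ?mulr1// pnatr_eq0.
Qed.

Lemma continuous_tpow al j : continuous (tpow al j).
Proof.
case: j => [|j] x; last first.
  by apply/differentiable_continuous/derivable1_diffP; case: (is_derive_tpow al j x).
rewrite /continuous_at /tpow; under eq_fun do rewrite expr0.
exact: cvg_cst.
Qed.

Lemma integral_tpow al be j : al <= be ->
  mu.-integrable `[al, be] (EFin \o tpow al j) /\
  \int[mu]_(x in `[al, be]) tpow al j x = tpow al j.+1 be.
Proof.
move=> ab; have [i ->] := integral_derive (is_derive_tpow al j) (@continuous_tpow al j) ab.
by split=> //; rewrite [X in _ - X]/tpow subrr expr0n mul0r subr0.
Qed.

(** [u n] stands for the n-th derivative of [u 0], but in integrated form, which is all that a weak
    solution provides. The remainder of order n+1 of [u m] is the integral of the remainder of order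
    n of [u m.+1]; hence the induction treats all [m] at once. *)
Lemma Taylor_real (u : nat -> R -> R) (al be M K : R) : 0 <= M -> 0 <= K ->
  (forall n s, al <= s <= be -> `|u n s| <= M * K ^+ n) ->
  (forall n s, al <= s <= be -> mu.-integrable `[al, s] (EFin \o u n.+1) /\
     u n s = u n al + \int[mu]_(r in `[al, s]) u n.+1 r) ->
  forall n m s, al <= s <= be ->
    `|u m s - \sum_(j < n) tpow al j s * u (m + j)%N al| <= M * K ^+ (m + n) * tpow al n s.
Proof.
move=> M0 K0 ub uE; elim=> [|n IH] m s /andP[als sbe].
  rewrite big_ord0 subr0 addn0 /tpow expr0 fact0 divr1 mulr1.
  by apply: ub; rewrite als.
have als' : al <= s <= be by rewrite als.
have [iu ->] := uE m s als'.
have mI := measurable_itv `[al, s].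
have iT j : mu.-integrable `[al, s] (EFin \o (fun r => tpow al j r * u (m.+1 + j)%N al)).
  have := integrableZr (mu := mu) mI (u (m.+1 + j)%N al) (integral_tpow j als).1.
  by apply: eq_integrable.
have iS : mu.-integrable `[al, s]
    (EFin \o (fun r => \sum_(j < n) tpow al j r * u (m.+1 + j)%N al)).
  have := @integrable_sum _ _ _ mu `[al, s] mI _ (index_enum 'I_n) xpredT
    (fun j => EFin \o (fun r => tpow al j r * u (m.+1 + j)%N al)) (fun j _ => iT j).
  by apply: eq_integrable => // r _; rewrite /= sumEFin.
have ES : \int[mu]_(r in `[al, s]) (\sum_(j < n) tpow al j r * u (m.+1 + j)%N al)
    = \sum_(j < n) tpow al j.+1 s * u (m.+1 + j)%N al.
  rewrite /Rintegral; under eq_integral do rewrite -sumEFin.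
  rewrite (@integral_sum _ _ _ mu `[al, s] mI _
    (fun (j : 'I_n) r => (tpow al j r * u (m.+1 + j)%N al)%:E) (fun j => iT j)).
  rewrite -sum_fine => [|j _]; last exact: integrable_fin_num (iT j).
  apply: eq_bigr => j _; rewrite -/(Rintegral _ _ _).
  by rewrite RintegralZr ?(integral_tpow j als).2 ?(integral_tpow j als).1.
(* The term [j = 0] cancels [u m al]; the other terms are the integrals of the Taylor terms of
   [u m.+1]. *)
have -> : u m al + \int[mu]_(r in `[al, s]) u m.+1 r -
    \sum_(j < n.+1) tpow al j s * u (m + j)%N al =
    \int[mu]_(r in `[al, s]) (u m.+1 r - \sum_(j < n) tpow al j r * u (m.+1 + j)%N al).
  rewrite RintegralB// ES big_ord_recl /= {1}/tpow expr0 fact0 divr1 mul1r addn0.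
  rewrite opprD addrACA subrr add0r; congr (_ - _); apply: eq_bigr => j _.
  by rewrite /bump /= add1n addnS.
have iB : mu.-integrable `[al, s]
    (EFin \o (fun r => u m.+1 r - \sum_(j < n) tpow al j r * u (m.+1 + j)%N al)).
  have := integrableB (mu := mu) mI iu iS; apply: eq_integrable => // r _.
apply: le_trans; first exact: (le_normr_Rintegral (mu := mu) mI iB).
have iC : mu.-integrable `[al, s] (EFin \o (fun r => M * K ^+ (m.+1 + n) * tpow al n r)).
  have := integrableZl (mu := mu) mI (M * K ^+ (m.+1 + n)) (integral_tpow n als).1.
  by apply: eq_integrable.
apply: (@le_trans _ _ (\int[mu]_(r in `[al, s]) (M * K ^+ (m.+1 + n) * tpow al n r))).
  apply: le_Rintegral => //; first exact: integrable_norm iB.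
  move=> r /=; rewrite in_itv /= => /andP[alr rs]; apply: IH.
  by rewrite alr (le_trans rs).
rewrite RintegralZl ?(integral_tpow n als).2 ?(integral_tpow n als).1//.
by rewrite addSnnS.
Qed.

(** The factor 2 comes from estimating the real and imaginary parts separately. *)
Lemma Taylor_complex (u : nat -> R -> R[i]) (al be M K : R) : 0 <= M -> 0 <= K ->
  (forall n s, al <= s <= be -> rnorm (u n s : R[i]^o) <= M * K ^+ n) ->
  (forall n s, al <= s <= be -> cintegrable `[al, s] (u n.+1) /\
     u n s = u n al + cintegral `[al, s] (u n.+1)) ->
  forall n s, al <= s <= be ->
    rnorm (u 0%N s - \sum_(j < n) (tpow al j s)%:C * u j al : R[i]^o)
    <= 2 * (M * K ^+ n * tpow al n s).
Proof.
move=> M0 K0 ub uE n s als; apply: (le_trans (rnorm_le_ReIm _)).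
have ReE : complex.Re (u 0%N s - \sum_(j < n) (tpow al j s)%:C * u j al) =
    complex.Re (u 0%N s) - \sum_(j < n) tpow al j s * complex.Re (u j al).
  rewrite raddfB raddf_sum /=; congr (_ - _); apply: eq_bigr => j _.
  by case: (u j al) => x y /=; rewrite mul0r subr0.
have ImE : complex.Im (u 0%N s - \sum_(j < n) (tpow al j s)%:C * u j al) =
    complex.Im (u 0%N s) - \sum_(j < n) tpow al j s * complex.Im (u j al).
  rewrite raddfB raddf_sum /=; congr (_ - _); apply: eq_bigr => j _.
  by case: (u j al) => x y /=; rewrite mul0r addr0.
rewrite ReE ImE mulr_natl mulr2n.
have hR := @Taylor_real (fun n s => complex.Re (u n s)) al be M K M0 K0 _ _ n 0%N s als.
have hI := @Taylor_real (fun n s => complex.Im (u n s)) al be M K M0 K0 _ _ n 0%N s als.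
rewrite lerD//.
  apply: hR => [k r alr|k r alr]; first by apply: le_trans (Re_le_rnorm _) _; exact: ub.
  have [[iR iI] E] := uE k r alr; split=> //.
  by rewrite {1}E raddfD.
apply: hI => [k r alr|k r alr]; first by apply: le_trans (Im_le_rnorm _) _; exact: ub.
have [[iR iI] E] := uE k r alr; split=> //.
by rewrite {1}E raddfD.
Qed.

End Taylor.

Section ComplexExponential.
Context {R : realType}.
Implicit Types z w : R[i].

Lemma cexpD z w : cexp (z + w) = cexp z * cexp w.
Proof.
case: z => a b; case: w => c d; rewrite /cexp /= expRD cosD sinD.
by apply/eqP; rewrite eq_complex /=; apply/andP; split; apply/eqP; ring.
Qed.

Lemma cexp0 : cexp 0 = 1 :> R[i].
Proof. by rewrite /cexp /= expR0 cos0 sin0 mul1r. Qed.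

Lemma cexpNK z : cexp (- z) * cexp z = 1.
Proof. by rewrite -cexpD addNr cexp0. Qed.

Lemma cexpNKl z w : cexp (- z) * (cexp z * w) = w.
Proof. by rewrite mulrA cexpNK mul1r. Qed.

Lemma rnorm_cexp z : rnorm (cexp z : R[i]^o) = expR (complex.Re z).
Proof.
rewrite /cexp rnormM rnormC ger0_norm ?expR_ge0//.
by rewrite /rnorm normc_def /= cos2Dsin2 sqrtr1 mulr1.
Qed.

Lemma is_derive_mulr (x s : R) : is_derive s (1 : R) (fun s : R => s * x) x.
Proof.
have -> : (fun s : R => s * x) = x \*: id by apply/funext => r; rewrite /= mulrC.
by apply: is_derive_eq; rewrite -[_ *: _]/(_ * _) mulr1.
Qed.

Lemma is_derive_cexp_Re w z (s : R) :
  is_derive s (1 : R) (fun s : R => complex.Re (w * cexp (s%:C * z)))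
    (complex.Re (w * z * cexp (s%:C * z))).
Proof.
case: w => a b; case: z => x y.
have dE : is_derive s (1 : R) (expR \o (fun s : R => s * x)) (expR (s * x) * x).
  by apply: is_derive1_comp; exact: is_derive_mulr.
have dc : is_derive s (1 : R) (cos \o (fun s : R => s * y)) (- sin (s * y) * y).
  by apply: is_derive1_comp; exact: is_derive_mulr.
have ds : is_derive s (1 : R) (sin \o (fun s : R => s * y)) (cos (s * y) * y).
  by apply: is_derive1_comp; exact: is_derive_mulr.
have -> : (fun s : R => complex.Re ((a +i* b) * cexp (s%:C * (x +i* y)))) =
    a \*: ((expR \o (fun s : R => s * x)) * (cos \o (fun s : R => s * y))) -
    b \*: ((expR \o (fun s : R => s * x)) * (sin \o (fun s : R => s * y))).
  by apply/funext => r; rewrite /cexp /= !fctE /= !(mul0r, subr0, addr0, add0r).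
apply: is_derive_eq; rewrite /cexp /= !(mul0r, subr0, addr0, add0r).
rewrite -!/(_ * _) /GRing.scale /=; ring.
Qed.

Lemma is_derive_cexp_Im w z (s : R) :
  is_derive s (1 : R) (fun s : R => complex.Im (w * cexp (s%:C * z)))
    (complex.Im (w * z * cexp (s%:C * z))).
Proof.
have ImE (u : R[i]) : complex.Im u = complex.Re ((0 -i* 1) * u).
  by case: u => a b /=; rewrite mul0r sub0r mulN1r opprK.
have -> : (fun s : R => complex.Im (w * cexp (s%:C * z))) =
    (fun s : R => complex.Re (((0 -i* 1) * w) * cexp (s%:C * z))).
  by apply/funext => r; rewrite ImE mulrA.
rewrite ImE -!mulrA (mulrA w) (mulrA _ (w * z)) (mulrA _ w).
exact: is_derive_cexp_Re.
Qed.

(** Taylor's estimate on [0, 1] for s -> e^(sz), with n-th derivative z^n e^(sz). It links the polar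
    form of [cexp] to the power series in which inner products on Fock space arise. *)
Lemma cexp_series z n :
  rnorm (cexp z - \sum_(j < n) (j`!%:R^-1)%:C * z ^+ j : R[i]^o) <=
  2 * (expR `|complex.Re z|) * (rnorm (z : R[i]^o) ^+ n / n`!%:R).
Proof.
pose u n (s : R) := z ^+ n * cexp (s%:C * z).
have h := @Taylor_complex R u 0 1 (expR `|complex.Re z|) (rnorm (z : R[i]^o))
  (expR_ge0 _) (rnorm_ge0 _) _ _ n 1.
have := h _ _; rewrite /u /tpow !subr0 expr1n mul1r.
under eq_bigr do rewrite mul0r cexp0 mulr1 expr1n mul1r.
rewrite expr0 !mul1r => {}h; apply: le_trans (h _ _ _) _ => {h}; last 2 first.
- by rewrite ler01 lexx.
- by rewrite !mulrA.
- move=> {}n s /andP[s0 s1]; rewrite rnormM rnormX mulrC ler_wpM2r ?exprn_ge0 ?rnorm_ge0//.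
  rewrite rnorm_cexp ler_expR; case: (z) => x y /=; rewrite mul0r subr0.
  apply: le_trans (ler_norm _) _; rewrite normrM (ger0_norm s0) ler_piMl//.
move=> {}n s /andP[s0 s1].
have cd (f g : R -> R) : (forall x, is_derive x (1 : R) f (g x)) -> continuous f.
  by move=> d x; apply/differentiable_continuous/derivable1_diffP; case: (d x).
have dR k x : is_derive x (1 : R) (fun s => complex.Re (u k s)) (complex.Re (u k.+1 x)).
  by rewrite /u exprSr; exact: is_derive_cexp_Re.
have dI k x : is_derive x (1 : R) (fun s => complex.Im (u k s)) (complex.Im (u k.+1 x)).
  by rewrite /u exprSr; exact: is_derive_cexp_Im.
have [iR ER] := integral_derive (dR n) (cd _ _ (dR n.+1)) s0.
have [iI EI] := integral_derive (dI n) (cd _ _ (dI n.+1)) s0.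
split; first by split.
rewrite /cintegral ER EI -/(u n s) -/(u n 0); case: (u n s) => a b; case: (u n 0) => c d.
by apply/eqP; rewrite eq_complex /=; apply/andP; split; apply/eqP; ring.
Qed.

End ComplexExponential.

(** * Exponential vectors and step functions *)

Section ExponentialVectors.
Context {R : realType} {L : hilbertType R} (F : fock_space L).
Implicit Types x y : L.

Lemma rnorm_eq_cvg0 (V : normedModType R[i]) (x y : V) (g : nat -> R) :
  g @ \oo --> (0 : R) -> (forall n, rnorm (x - y) <= g n) -> x = y.
Proof.
move=> g0 h; apply: (@rnorm_eps_eq _ _ _ _ 1) => // e e0.
have /cvgrPdist_lt/(_ _ e0)[n _ hn] := g0.
have := hn n (leqnn n); rewrite /= sub0r normrN mul1r => gn.
by apply: le_trans (h n) _; apply: le_trans (ler_norm _) (ltW gn).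
Qed.

Let term x n : F := ((Num.sqrt (n`!%:R : R))^-1)%:C *: fock_pow F n x.

Let dot_term x y m n :
  dot (term x m) (term y n) = (m == n)%:R * ((n`!%:R^-1)%:C * dot x y ^+ n).
Proof.
rewrite /term dotZl dotZr fock_dot conjc_real.
case: eqVneq => [->|]; last by rewrite !mul0r !mulr0.
rewrite !mul1r mulrA -complexCM -invfM -expr2 sqr_sqrtr//.
Qed.

Let psum x n : F := \sum_(0 <= j < n) term x j.

Let dot_psum x y m n : (m <= n)%N ->
  dot (psum x m) (psum y n) = \sum_(j < m) (j`!%:R^-1)%:C * dot x y ^+ j.
Proof.
move=> mn; rewrite /psum dot_suml big_mkord; apply: eq_bigr => i _.
rewrite dot_sumr (bigD1_seq (i : nat)) ?mem_index_iota ?iota_uniq//=; last first.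
  by rewrite (leq_trans (ltn_ord i)).
rewrite dot_term eqxx mul1r big1 ?addr0// => j ji.
by rewrite dot_term eq_sym (negbTE ji) mul0r.
Qed.

Let q x : R := rnorm x ^+ 2.

Let E x n : R := series (exp_coeff (q x)) n.

Let rnorm_psumE x n : rnorm (psum x n) ^+ 2 = E x n.
Proof.
apply: (@complexI R); rewrite -dotxxE dot_psum// /E /series /=.
rewrite big_mkord rmorph_sum; apply: eq_bigr => j _.
by rewrite dotxxE -complexCX -complexCM mulrC /exp_coeff.
Qed.

Let rnorm_psumB x m n : (m <= n)%N -> rnorm (psum x n - psum x m) ^+ 2 = E x n - E x m.
Proof.
move=> mn; apply: (@complexI R); rewrite -dotxxE !dotBr !dotBl !dotxxE !rnorm_psumE.
have h : dot (psum x m) (psum x n) = (E x m)%:C.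
  by rewrite dot_psum// -(@dot_psum x x m m)// dotxxE rnorm_psumE.
by rewrite (dotC (psum x m)) h conjc_real complexCB; ring.
Qed.

Let E_le x m n : (m <= n)%N -> E x m <= E x n.
Proof. by move=> mn; rewrite -subr_ge0 -rnorm_psumB// sqr_ge0. Qed.

Let E_cvg x : E x @ \oo --> expR (q x).
Proof. exact: is_cvg_series_exp_coeff. Qed.

Let E_lim x n : E x n <= expR (q x).
Proof.
have h := @E_cvg x; rewrite -(cvg_lim (@Rhausdorff R) h).
apply: nondecreasing_cvgn_le; last by apply/cvg_ex; exists (expR (q x)).
by move=> m k mk; exact: E_le.
Qed.

(** Orthogonality of the n-particle components makes the squared distance of two partial sums a
    difference of partial sums of the series of exp(rnorm x ^+ 2); this is the square root of its
    tail. *)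
Let e x n : R := Num.sqrt (expR (q x) - E x n).

Let e_cvg x : e x @ \oo --> (0 : R).
Proof.
rewrite -(@sqrtr0 R) -(subrr (expR (q x))).
apply: continuous_cvg; first exact: sqrt_continuous.
by apply: cvgB; [exact: cvg_cst|exact: E_cvg].
Qed.

Let psum_cauchy x n m : rnorm (psum x n - psum x m) <= e x n + e x m.
Proof.
wlog mn : n m / (m <= n)%N.
  move=> h; have [/h|/ltnW/h//] := leqP n m.
  by rewrite rnormBC [e x m + _]addrC.
apply: (@le_trans _ _ (e x m)); last by rewrite lerDr sqrtr_ge0.
rewrite -[leLHS]ger0_norm ?rnorm_ge0// -sqrtr_sqr ler_wsqrtr// rnorm_psumB//.
by rewrite lerD2r E_lim.
Qed.

Let psum_expvec x n : rnorm (psum x n - expvec F x) <= e x n.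
Proof.
have [v [hv ev]] := rnorm_complete (@e_cvg x) (@psum_cauchy x).
suff -> : expvec F x = v by [].
exact: (cvg_lim (@norm_hausdorff _ _) hv).
Qed.

Lemma dot_expvec x y : dot (expvec F x) (expvec F y) = cexp (dot x y).
Proof.
pose vx := expvec F x; pose vy := expvec F y.
pose M := 2 * expR `|complex.Re (dot x y)|.
(* The first summand bounds the error of replacing both vectors by partial sums, the second that of
   truncating the exponential series of [dot x y]. *)
pose g n : R := (rnorm vx * e y n + e x n * (rnorm vy + e y n)) +
  M * exp_coeff (rnorm (dot x y : R[i]^o)) n.
apply: (@rnorm_eq_cvg0 R[i]^o _ _ g).
  have -> : (0 : R) = (rnorm vx * 0 + 0 * (rnorm vy + 0)) + M * 0 by ring.
  apply: cvgD; last by apply: cvgMr; exact: cvg_exp_coeff.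
  apply: cvgD; first by apply: cvgMr; exact: e_cvg.
  apply: cvgM; first exact: e_cvg.
  by apply: cvgD; [exact: cvg_cst|exact: e_cvg].
move=> n; apply: le_trans (rnorm_tri (dot (psum x n) (psum y n) : R[i]^o) _ _) _.
rewrite lerD//; last by rewrite rnormBC dot_psum//; exact: cexp_series.
have -> : dot vx vy - dot (psum x n) (psum y n) =
    dot vx (vy - psum y n) + dot (vx - psum x n) (psum y n).
  by rewrite dotBr dotBl addrA subrK.
apply: le_trans (rnormD _ _) _; apply: lerD; apply: le_trans (Cauchy_Schwarz _ _) _.
  by rewrite ler_wpM2l ?rnorm_ge0// rnormBC psum_expvec.
rewrite ler_pM ?rnorm_ge0//; first by rewrite rnormBC psum_expvec.
rewrite -[psum y n](subrK vy) addrC; apply: le_trans (rnormD _ _) _.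
by rewrite lerD2l psum_expvec.
Qed.

End ExponentialVectors.

Section SimpleFunctions.
Context {R : realType} {k : hilbertType R}.
Local Notation mu := (@lebesgue_measure R).
Implicit Types (f g : R -> k) (A J : set R).

(** A class that contains the step functions, consists of square-integrable functions and is stable
    under restriction to every measurable set. *)
Definition finite_simple : set (R -> k) :=
  lin [set f | exists A d, [/\ measurable A, (mu A < +oo)%E & f = restr A (fun=> d)]].

Lemma restrE J f s : restr J f s = if s \in J then f s else 0.
Proof. by []. Qed.

Lemma restrI J A f : restr J (restr A f) = restr (J `&` A) f.
Proof.
by apply/funext => s; rewrite !restrE in_setI; case: (s \in J); case: (s \in A).
Qed.

Lemma restr_linear J (a : R[i]) f g :
  restr J (a *: f + g) = a *: restr J f + restr J g.
Proof.
apply/funext => s; rewrite restrE !fctE !restrE.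
by case: ifP => // _; rewrite scaler0 addr0.
Qed.

Lemma restr0 J : restr J (0 : R -> k) = 0.
Proof. by apply/funext => s; rewrite restrE if_same. Qed.

Lemma restr_lin J (B : set (R -> k)) (D : set (R -> k)) :
  subspace D -> (forall f, B f -> D (restr J f)) ->
  forall f, lin B f -> D (restr J f).
Proof.
move=> sD BD; apply: lin_ind => //; split; first by rewrite /= restr0; exact: sD.1.
by move=> a f g /= Df Dg; rewrite /= restr_linear; exact: sD.2.
Qed.

Lemma finite_simple_restr J f : measurable J -> finite_simple f -> finite_simple (restr J f).
Proof.
move=> mJ; apply: restr_lin; first exact: lin_subspace.
move=> _ [A [d [mA fA ->]]]; apply: lin_sub; exists (J `&` A), d; split.
- exact: measurableI.
- by apply: le_lt_trans fA; apply: le_measure; rewrite ?inE//; exact: measurableI.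
- exact: restrI.
Qed.

Lemma step_finite_simple f : step_fun f -> finite_simple f.
Proof.
apply: lin_ind; first exact: lin_subspace.
move=> _ [d [s [s0 ->]]]; apply: lin_sub; exists `[0, s[%classic, d; split=> //.
by rewrite lebesgue_measure_itv /=; case: ifP => // _; rewrite ltry.
Qed.

Lemma step_restr f (t : R) : 0 <= t -> step_fun f -> step_fun (restr `[0, t[ f).
Proof.
move=> t0; apply: restr_lin; first exact: lin_subspace.
move=> _ [d [s [s0 ->]]]; apply: lin_sub; exists d, (Num.min t s).
split; first by rewrite le_min t0.
rewrite restrI; congr restr; apply/seteqP; split=> r /=.
  by rewrite !in_itv /= => -[/andP[-> ht] /andP[_ hs]]; rewrite lt_min ht.
by rewrite !in_itv /= lt_min => /and3P[-> -> ->].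
Qed.

Lemma step_cst (d : k) (t : R) : 0 <= t -> step_fun (restr `[0, t[ (fun=> d)).
Proof. by move=> t0; apply: lin_sub; exists d, t. Qed.

(** The sets in a representation of [f] may overlap, so the squared norm is expanded as a double sum
    over the indicators of their pairwise intersections. *)
Lemma finite_simple_sqintegrable f : finite_simple f -> sqintegrable f.
Proof.
move=> sf; split.
  exists (fun=> f); split=> [n|x _]; last exact: cvg_cst.
  apply: lin_ind sf; first exact: lin_subspace.
  by move=> _ [A [d [mA _ ->]]]; apply: lin_sub; exists A, d.
case: sf => n [a [v [Av ->]]].
have [A hA] := choice Av.
have [d hd] := choice hA.
have mhalf := measurable_itv `[(0 : R), +oo[; rewrite -/halfline in mhalf.
pose c i j := complex.Re (conjc (a i) * (a j * dot (d i) (d j))).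
have iij (i j : 'I_n) : mu.-integrable halfline
    (EFin \o (fun s => c i j * \1_(A i `&` A j) s)).
  have [mAi fi _] := hd i; have [mAj _ _] := hd j.
  have mA := measurableI _ _ mAi mAj.
  have i1 : mu.-integrable halfline (EFin \o \1_(A i `&` A j)).
    apply/integrableP; split; first exact/measurable_EFinP/measurable_indic.
    under eq_integral => x _ do rewrite /= ger0_norm//.
    rewrite integral_indic//; apply: le_lt_trans fi; apply: le_measure.
    - by rewrite inE; exact: measurableI.
    - by rewrite inE.
    - by move=> x [[]].
  have := integrableZl (mu := mu) mhalf (c i j) i1.
  by apply: eq_integrable.
have isum1 i := @integrable_sum _ _ _ mu halfline mhalf _ (index_enum 'I_n) xpredT
  (fun j => EFin \o (fun s => c i j * \1_(A i `&` A j) s)) (fun j _ => iij i j).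
have isum := @integrable_sum _ _ _ mu halfline mhalf _ (index_enum 'I_n) xpredT
  _ (fun i _ => isum1 i).
apply: eq_integrable isum => //= s _.
rewrite (eq_bigr (fun i => (\sum_(j < n) c i j * \1_(A i `&` A j) s)%:E)) => [|i _]; last first.
  by rewrite sumEFin.
rewrite sumEFin; congr EFin.
have -> (x : k) : rnorm x ^+ 2 = complex.Re (dot x x) by rewrite dotxxE.
rewrite fct_sumE dot_suml raddf_sum; apply: eq_bigr => i _.
rewrite dot_sumr raddf_sum; apply: eq_bigr => j _.
have [_ _ ->] := hd i; have [_ _ ->] := hd j.
rewrite !fctE !restrE dotZl dotZr indicE in_setI /c.
case: (s \in A i); last by rewrite dot0l !mulr0.
by case: (s \in A j); rewrite ?dot0r ?mulr0 ?mulr1.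
Qed.

(** A combination of indicators of intervals [0, s[ is constant on a right neighbourhood of every
    point, in particular of [al], where continuity is not assumed. Let m be the supremum of the
    points up to which f equals f(al). Continuity from the left gives f(m) = f(al), and right
    constancy then leads beyond m unless m = x. *)
Lemma const_of_continuous (f : R -> k) (al be : R) : step_fun f ->
  (forall x, al < x < be -> {for x, continuous f}) ->
  forall x, al <= x < be -> f x = f al.
Proof.
move=> sf.
pose right_cst (g : R -> k) :=
  forall x : R, exists2 e : R, 0 < e & forall y, x <= y < x + e -> g y = g x.
have rc : right_cst f.
  apply: (lin_ind (D := right_cst) _ _ sf) => [|_ [d [s [s0 ->]]]] /=.
    split=> [x|a g h rg rh x]; first by exists 1.
    have [e1 e10 h1] := rg x; have [e2 e20 h2] := rh x.
    exists (Num.min e1 e2); first by rewrite lt_min e10.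
    move=> y /andP[xy yx]; rewrite !fctE h1 ?h2// xy (lt_le_trans yx)// lerD2l ge_min lexx ?orbT//.
  move=> x; have [sx|xs] := leP s x.
    exists 1 => // y /andP[xy _]; rewrite !restrE !mem_setE !in_itv /=.
    by rewrite (ltNge y) (le_trans sx xy) (ltNge x) sx !andbF.
  have [x0|x0] := leP 0 x.
    exists (s - x); first by rewrite subr_gt0.
    move=> y /andP[xy]; rewrite addrC subrK => ys; rewrite !restrE !mem_setE !in_itv /=.
    by rewrite ys xs x0 (le_trans x0 xy).
  exists (- x); first by rewrite oppr_gt0.
  move=> y /andP[xy]; rewrite subrr => y0; rewrite !restrE !mem_setE !in_itv /=.
  by rewrite leNgt y0 leNgt x0.
move=> cf x /andP[alx xbe].
pose S := [set y | al <= y <= x /\ forall z, al <= z <= y -> f z = f al].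
have Sal : S al.
  by split; rewrite ?lexx// => z; rewrite -eq_le => /eqP <-.
have hS : has_sup S by split; [exists al|exists x => y [/andP[]]].
pose m := sup S.
have alm : al <= m by apply: ub_le_sup => //; exact: hS.2.
have mx : m <= x by apply: ge_sup => [|y [/andP[]]//]; exact: hS.1.
have fm0 z : al <= z < m -> f z = f al.
  move=> /andP[alz zm]; have [y Sy zy] := sup_gt hS.1 zm.
  by case: Sy => _; apply; rewrite alz ltW.
have fm : f m = f al.
  move: (alm); rewrite le_eqVlt => /predU1P[->//|alm'].
  have cm : {for m, continuous f} by apply: cf; rewrite alm' (le_lt_trans mx).
  apply: (cvg_unique (@norm_hausdorff _ _) (cvg_at_left_filter cm)).
  apply: cvg_near_cst; near=> z; apply: fm0.
  apply/andP; split; first by apply: ltW; near: z; exact: nbhs_left_gt.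
  by near: z; exact: nbhs_left_lt.
have [e e0 he] := rc m.
move: (mx); rewrite le_eqVlt => /predU1P[<-//|mx'].
pose y := Num.min x (m + e / 2).
have my : m < y by rewrite lt_min mx' ltrDl divr_gt0.
suff : S y by move=> /(ub_le_sup hS.2); rewrite leNgt my.
split; first by rewrite ge_min lexx andbT (le_trans alm)// ltW.
move=> z /andP[alz zy]; have [zm|mz] := ltP z m; first by apply: fm0; rewrite alz.
rewrite he// mz (le_lt_trans zy)// (@le_lt_trans _ _ (m + e / 2))//.
  by rewrite ge_min lexx orbT.
by rewrite ltrD2l gtr_pMr// invf_lt1// ltr1n.
Unshelve. all: by end_near. Qed.

Lemma dot_L2_cst (L : L2_space k) (c d : k) (t : R) : 0 <= t ->
  dot (L2_class L (restr `[0, t[ (fun=> c))) (L2_class L (restr `[0, t[ (fun=> d))) =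
  t%:C * dot c d.
Proof.
move=> t0.
have sq (x : k) : sqintegrable (restr `[0, t[ (fun=> x)).
  exact/finite_simple_sqintegrable/step_finite_simple/step_cst.
rewrite L2_dot//.
have mt : fine (mu `[0, t[) = t.
  rewrite lebesgue_measure_itv /= lte_fin; move: t0; rewrite le_eqVlt.
  by case/predU1P => [<-|->]; rewrite ?ltxx//= oppr0 addr0.
have sub : halfline `&` `[0, t[ = `[0, t[%classic :> set R.
  by apply/setIidPr => x /=; rewrite /halfline /= !in_itv /= => /andP[-> _].
have int (g : R[i] -> R) : g 0 = 0 ->
    \int[mu]_(s in halfline) g (dot (restr `[0, t[ (fun=> c) s) (restr `[0, t[ (fun=> d) s)) =
    t * g (dot c d).
  move=> g0.
  transitivity (\int[mu]_(s in halfline) ((fun=> g (dot c d)) \_ `[0, t[) s).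
    apply: eq_Rintegral => s _; rewrite !restrE patchE.
    by case: ifP => // _; rewrite dot0r.
  rewrite -Rintegral_mkcondr sub Rintegral_cst; last exact: measurable_itv.
  by rewrite mt mulrC.
rewrite /cintegral !int//; case: (dot c d) => x y /=.
by apply/eqP; rewrite eq_complex /= !(mul0r, subr0, addr0) !eqxx.
Qed.

End SimpleFunctions.

(** * Weak solutions and cocycles *)

Section TimeZero.
Context {R : realType} (C : os_coalgebra R) (k : hilbertType R)
  (L : L2_space k) (F : fock_space L).
Implicit Types (f g : R -> k) (l : R -> bop (os_H C) -> F -> F).

Lemma dot_ev f g : dot (ev F f) (ev F g) = cexp (dot (L2_class L f) (L2_class L g)).
Proof. exact: dot_expvec. Qed.

Lemma dot_ev_neq0 f g : dot (ev F f) (ev F g) != 0.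
Proof.
rewrite dot_ev; apply/negP => /eqP h; have := cexpNK (dot (L2_class L f) (L2_class L g)).
by rewrite h mulr0 => /eqP; rewrite eq_sym oner_eq0.
Qed.

Lemma fock_on_empty (X : F) : fock_on (F := F) `[0, 0[ X -> exists z : R[i], X = z *: ev F 0.
Proof.
move=> hX; pose w := ev F 0; pose N := dot w w.
have N0 : N != 0 by exact: dot_ev_neq0.
exists (N^-1 * dot w X); rewrite -scalerA -/w.
(* Being a multiple of [w] is put as an equation linear and continuous in the vector, so that it
   passes from the span to its closure. *)
suff E : N *: X = dot w X *: w by rewrite -E scalerA mulVf// scale1r.
apply: (@rnorm_eps_eq _ _ _ _ (rnorm (N : R[i]^o) + rnorm w * rnorm w)).
  by rewrite addr_ge0 ?mulr_ge0 ?rnorm_ge0.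
move: hX => /closure_rnormP hX e /hX[Y lY /ltW XY].
have EY : N *: Y = dot w Y *: w.
  have sD : subspace [set Y : F | N *: Y = dot w Y *: w].
    split; first by rewrite /= dot0r scaler0 scale0r.
    move=> a x y /= hx hy; rewrite scalerDr scalerA mulrC -scalerA hx hy.
    by rewrite dotDr dotZr scalerDl scalerA.
  apply: (lin_ind sD _ lY) => _ [f [_ f0] <-].
  have -> : f = 0.
    apply/funext => s; apply: f0; rewrite /= in_itv /= => /andP[/le_lt_trans h /h].
    by rewrite ltxx.
  by [].
rewrite -(subrKA (N *: Y)) -scalerBr EY -scalerBl -dotBr.
apply: le_trans (rnormD _ _) _; rewrite !rnormZ mulrDl lerD//.
  by rewrite ler_wpM2l ?rnorm_ge0.
apply: le_trans (ler_wpM2r (rnorm_ge0 _) (Cauchy_Schwarz _ _)) _.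
by rewrite mulrAC ler_wpM2l ?mulr_ge0 ?rnorm_ge0// rnormBC.
Qed.

Lemma step_restr_sqintegrable f (J : set R) : measurable J -> step_fun f ->
  sqintegrable (restr J f).
Proof.
by move=> mJ sf; apply/finite_simple_sqintegrable/finite_simple_restr/step_finite_simple.
Qed.

(** At t = 0 the past factor of ev f is the vacuum, which [X] maps to a multiple z of itself;
    bilinearity of [m] and the factorization of ev f carry z outside. *)
Lemma adapted_op0 (T : F -> F) f : adapted_op 0 T -> step_fun f ->
  exists z : R[i], T (ev F f) = z *: ev F f.
Proof.
move=> [m [X [[mP mev] lX XE TE]]] sf.
have r0 g : restr `[0, 0[ g = 0.
  apply/funext => s; rewrite restrE mem_setE in_itv /=.
  by case: ifP => // /andP[/le_lt_trans h /h]; rewrite ltxx.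
have sw : step_fun (0 : R -> k) by exact: (lin_subspace _).1.
have sq f' : step_fun f' -> sqintegrable f'.
  by move=> h; exact/finite_simple_sqintegrable/step_finite_simple.
have fw : fock_on (F := F) `[0, 0[ (ev F 0).
  by apply/subset_closure/lin_sub; exists 0 => //; split=> //; exact: sq.
have [z zE] : exists z, X (ev F 0) = z *: ev F 0.
  by apply/fock_on_empty/XE/lin_sub; exists 0 => //; rewrite r0.
exists z; rewrite TE// r0 zE.
have fy : fock_on (F := F) `[0, +oo[ (ev F (restr `[0, +oo[ f)).
  apply/subset_closure/lin_sub; exists (restr `[0, +oo[ f) => //; split.
    by apply: step_restr_sqintegrable => //; exact: measurable_itv.
  by move=> s /= hs; rewrite restrE mem_setE; case: ifP.
rewrite (linear_onZ _ (tens_linl mP fy))//; last exact/closure_subspace/lin_subspace.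
by have := mev f (sq f sf); rewrite r0 => ->.
Qed.

Variables (phi : bop (os_H C) -> bop (khat k)) (l : R -> bop (os_H C) -> F -> F).
Hypothesis hl : weak_solution phi l.

Lemma weak_solution0 a u : os_C C a -> exp_domain u -> l 0 a u = os_eps C a *: u.
Proof.
move=> Ca; have [pl _ eql] := hl.
have ll := proc_op pl (lexx 0) Ca.
have sE : subspace (@exp_domain _ _ _ F) by exact: lin_subspace.
suff sD : subspace [set u | exp_domain u /\ l 0 a u = os_eps C a *: u].
  move=> du; suff : [set u | exp_domain u /\ l 0 a u = os_eps C a *: u] u by case.
  apply: (lin_ind sD _ du) => _ [f sf <-]; split; first by apply: lin_sub; exists f.
  have [z zE] := adapted_op0 (proc_adapted pl (lexx 0) Ca) sf.
  (* The integral over the single point 0 vanishes, and the pairing of [ev F f] with itself is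
     nonzero; this identifies z with eps(a). *)
  have [_] := eql f f 0 a sf sf (lexx 0) Ca.
  rewrite /cintegral set_itv1 !Rintegral_set1 zE -scalerBl dotZr => /eqP.
  by rewrite mulf_eq0 (negbTE (dot_ev_neq0 _ _)) orbF subr_eq0 => /eqP ->.
split; first by split; [exact: sE.1|rewrite (linear_on0 sE ll) scaler0].
move=> c x y [dx xE] [dy yE]; split; first exact: sE.2.
by rewrite ll// xE yE scalerDr !scalerA mulrC.
Qed.

End TimeZero.

Section BoundedCombinations.
Context {R : realType} (V W : normedModType R[i]) (A : set V).
Implicit Types f g : V -> W.

Lemma bounded_onZ (z : R[i]) f : bounded_on A f -> bounded_on A (fun x => z *: f x).
Proof.
move=> [lf [M M0 hM]]; split=> [a x y Ax Ay|].
  by rewrite lf// scalerDr !scalerA mulrC.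
exists (rnorm (z : R[i]^o) * M); first by rewrite mulr_ge0 ?rnorm_ge0.
by move=> x Ax; rewrite rnormZ -mulrA ler_wpM2l ?rnorm_ge0 ?hM.
Qed.

Lemma bounded_onD f g : bounded_on A f -> bounded_on A g ->
  bounded_on A (fun x => f x + g x).
Proof.
move=> [lf [M M0 hM]] [lg [N N0 hN]]; split=> [a x y Ax Ay|].
  by rewrite lf// lg// scalerDr addrACA.
exists (M + N); first exact: addr_ge0.
move=> x Ax; apply: le_trans (rnormD _ _) _; rewrite mulrDl.
by apply: lerD; [exact: hM|exact: hN].
Qed.

Lemma bounded_on_sum n (z : nat -> R[i]) (f : nat -> V -> W) :
  (forall i, bounded_on A (f i)) ->
  bounded_on A (fun x => \sum_(i < n) z i *: f i x).
Proof.
move=> bf; elim: n => [|n IH].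
  split=> [a x y _ _|]; first by rewrite !big_ord0 scaler0 addr0.
  by exists 0 => // x _; rewrite big_ord0 rnorm0 mul0r.
have := bounded_onD IH (bounded_onZ (z n) (bf n)).
by under [X in _ -> bounded_on A X]eq_fun do rewrite big_ord_recr.
Qed.

End BoundedCombinations.

(** * Integrals over divided intervals *)

Section IntervalIntegrals.
Context {R : realType}.
Local Notation mu := (@lebesgue_measure R).

(** Agreement is asked only on [al, s[, because the step functions may jump at [s]; the endpoint is
    a null set. *)
Lemma Rintegral_cut (v w : R -> R) (al s : R) : 0 <= al -> al <= s ->
  mu.-integrable `[0, s] (EFin \o w) -> mu.-integrable `[al, s] (EFin \o v) ->
  (forall r, al <= r < s -> w r = v r) ->
  \int[mu]_(r in `[0, s]) w r =
  \int[mu]_(r in `[0, al]) w r + \int[mu]_(r in `[al, s]) v r.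
Proof.
move=> al0 als iw iv wv.
have iwo : mu.-integrable `]al, s] (EFin \o w).
  apply: (integrableS (mu := mu) (measurable_itv `[0, s]) (measurable_itv `]al, s])) => //.
  by apply: subset_itvr; rewrite bnd_simp.
have iwc : mu.-integrable `[al, s[ (EFin \o w).
  apply: (integrableS (mu := mu) (measurable_itv `[0, s]) (measurable_itv `[al, s[)) => //.
  by apply: subset_itv; rewrite bnd_simp.
have ivc : mu.-integrable `[al, s[ (EFin \o v).
  apply: (integrableS (mu := mu) (measurable_itv `[al, s]) (measurable_itv `[al, s[)) => //.
  by apply: subset_itvl; rewrite bnd_simp.
have := @Rintegral_itvB _ w (BLeft 0) (BRight s) al iw.
rewrite !bnd_simp => /(_ al0 als) /eqP; rewrite subr_eq addrC => /eqP ->; congr (_ + _).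
rewrite Rintegral_itv_obnd_cbnd// -Rintegral_itv_bndo_bndc// -Rintegral_itv_bndo_bndc//.
by apply: eq_Rintegral => r; rewrite inE /= in_itv /=; exact: wv.
Qed.

(** The right side is independent of [s]: it gives, for a fixed element of the coalgebra, the
    pointwise bound that uniform boundedness asks for. *)
Lemma normr_Rintegral_itv (w : R -> R) (s T : R) : s <= T ->
  mu.-integrable `[0, T] (EFin \o w) ->
  `|\int[mu]_(r in `[0, s]) w r| <= \int[mu]_(r in `[0, T]) `|w r|.
Proof.
move=> sT iw.
have sub : (`[0, s] : set R) `<=` `[0, T] by apply: subset_itvl; rewrite bnd_simp.
have ms := measurable_itv `[(0 : R), s]; have mT := measurable_itv `[(0 : R), T].
have iws := integrableS (mu := mu) mT ms sub iw.
apply: le_trans; first exact: (le_normr_Rintegral (mu := mu) ms iws).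
have iN := integrable_norm iw; have iNs := integrable_norm iws.
rewrite /Rintegral fine_le//.
- exact: (integrable_fin_num (mu := mu) ms iNs).
- exact: (integrable_fin_num (mu := mu) mT iN).
- apply: (ge0_subset_integral mu ms mT) => //.
  by case/integrableP : iN.
Qed.

End IntervalIntegrals.

(** * Expansion of the solution, cocycle identity and semigroups *)

Section Cocycle.
Context {R : realType} (C : os_coalgebra R) (k : hilbertType R)
  (L : L2_space k) (F : fock_space L)
  (phi : bop (os_H C) -> bop (khat k)) (l : R -> bop (os_H C) -> F -> F).
Hypothesis hphi : completely_bounded phi.
Hypothesis hl : weak_solution phi l.
Implicit Types (f g : R -> k) (c d : k) (a b : bop (os_H C)).
Local Notation leb := (@lebesgue_measure R).
Local Notation CC := (os_C C).
Local Notation eps := (os_eps C).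
Local Notation bfun := (@bounded_on R _ CC R[i]^o).

Let pl : process l. Proof. by case: hl. Qed.
Let sC := os_subspace C.

Let mu f g (s : R) b : R[i]^o := dot (ev F f) (l s b (ev F g)).
Let chi c d b : R[i]^o := dot (hat c) (phi b (hat d)).

Let ev_dom g : step_fun g -> exp_domain (ev F g).
Proof. by move=> sg; apply: lin_sub; exists g. Qed.

Let bounded_mu f g s : step_fun f -> step_fun g -> 0 <= s -> bfun (mu f g s).
Proof.
move=> sf sg s0; apply: bounded_onI.
  move=> z a b Ca Cb; rewrite /mu.
  by rewrite (proc_linear pl s0 (ev_dom sg))// dotDr dotZr.
by case: hl => _ wb _; exact: (wb s f g s0 sf sg).
Qed.

Let bounded_chi c d : bfun (chi c d).
Proof.
have [lphi [M hM]] := hphi; apply: bounded_on_dot_comp; apply: bounded_onI => //.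
by exists M; exact: (cb_le_bop1 hM).
Qed.

Let mu_integral f g a : step_fun f -> step_fun g -> CC a ->
  exists h : R -> R[i], [/\ forall s : R, 0 <= s -> h s = mu f g s (rconv (chi (f s) (g s)) a),
    forall s : R, 0 <= s -> cintegrable `[0, s] h &
    forall s : R, 0 <= s -> mu f g s a = eps a * dot (ev F f) (ev F g) + cintegral `[0, s] h].
Proof.
move=> sf sg Ca; have [_ _ H] := hl.
exists (fun s => convol (mu f g s) (chi (f s) (g s)) a); split=> s s0.
- by rewrite convolE//; exact: bounded_mu.
- by have [] := H f g s a sf sg s0 Ca.
- have [_ <-] := H f g s a sf sg s0 Ca.
  by rewrite /mu dotBr dotZr addrC subrK.
Qed.

Let mu0 f g a : step_fun f -> step_fun g -> CC a ->
  mu f g 0 a = dot (ev F f) (ev F g) * eps a.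
Proof.
move=> sf sg Ca; rewrite /mu (weak_solution0 hl Ca (ev_dom sg)) dotZr.
exact: mulrC.
Qed.

(** Each mu_s is bounded by weak boundedness, and for each [a] the equation bounds mu_s(a) over
    [0, T] through integrals of absolute values. Uniform boundedness, indexed by the times in
    [0, T], combines the two. *)
Let mu_uniform f g (T : R) : step_fun f -> step_fun g -> 0 <= T ->
  exists2 M : R, 0 <= M &
    forall s a, 0 <= s <= T -> CC a -> rnorm (mu f g s a) <= M * rnorm a.
Proof.
move=> sf sg T0.
have bI (i : {s : R | 0 <= s <= T}) : bfun (mu f g (sval i)).
  by case: i => s /= /andP[s0 _]; exact: bounded_mu.
have [a Ca|M M0 hM] := uniform_boundedness sC (@os_C_closed _ C) bI.
  have [h [_ ih hE]] := mu_integral sf sg Ca.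
  have [iR iI] := ih T T0.
  exists (rnorm (eps a * dot (ev F f) (ev F g) : R[i]^o) +
    (\int[leb]_(r in `[0, T]) `|complex.Re (h r)| +
     \int[leb]_(r in `[0, T]) `|complex.Im (h r)|)) => -[s /= /andP[s0 sT]].
  rewrite hE//; apply: le_trans (rnormD _ _) _; rewrite lerD2l.
  apply: le_trans (rnorm_le_ReIm _) _; rewrite /cintegral /=.
  by rewrite lerD// (normr_Rintegral_itv sT).
by exists M => // s a hs Ca; exact: (hM (exist _ s hs)).
Qed.

Let P c d := rconv (chi c d).

Let P_in c d n a : CC a -> CC (iter n (P c d) a).
Proof. by move=> Ca; elim: n => //= n IH; exact: rconv_in. Qed.

Let P_bound c d : exists2 K : R, 0 <= K &
  forall n a, CC a -> rnorm (iter n (P c d) a) <= K ^+ n * rnorm a.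
Proof.
have [_ [K K0 hK]] := bounded_rconv (bounded_chi c d).
exists K => // n a Ca; elim: n => [|n IH] /=; first by rewrite mul1r.
apply: le_trans (hK _ (P_in _ _ _ Ca)) _.
by rewrite exprS -mulrA ler_wpM2l.
Qed.

Let mu_integrable f g (al s : R) a : step_fun f -> step_fun g -> 0 <= al -> al <= s ->
  CC a -> cintegrable `[al, s] (mu f g ^~ a).
Proof.
move=> sf sg al0 als Ca.
have [M M0 hM] := mu_uniform sf sg (le_trans al0 als).
have [mR mI] := proc_meas pl (ev F f) Ca (ev_dom sg).
have sub : (`[al, s] : set R) `<=` halfline.
  by apply: subset_itv; rewrite bnd_simp.
have mals := measurable_itv `[al, s].
have bnd (u : R -> R) : measurable_fun halfline u ->
    (forall r, al <= r <= s -> `|u r| <= M * rnorm a) ->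
    leb.-integrable `[al, s] (EFin \o u).
  move=> mu' hu; apply: (measurable_bounded_integrable (mu := leb)) => //.
  - have fin : (@lebesgue_measure R `[al, s] < +oo)%E.
      by rewrite lebesgue_measure_itv /=; case: ifP => // _; rewrite -EFinB ltry.
    exact: fin.
  - by apply: measurable_funS mu' => //; exact: measurable_itv.
  - exists (M * rnorm a); split; first by rewrite num_real.
    move=> x hx r /= /[!in_itv] /= har; apply: le_trans (hu r har) (ltW hx).
split; apply: bnd => // r /andP[ar rs].
  by apply: le_trans (Re_le_rnorm _) _; apply: hM => //; rewrite (le_trans al0 ar).
by apply: le_trans (Im_le_rnorm _) _; apply: hM => //; rewrite (le_trans al0 ar).
Qed.

(** The equation restarted at [al]: on [al, s[ the operator P_(chi_r) is the fixed [P c d]. *)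
Let mu_step f g c d (al s : R) a : step_fun f -> step_fun g -> 0 <= al -> al <= s ->
  (forall r, al <= r < s -> f r = c /\ g r = d) -> CC a ->
  mu f g s a = mu f g al a + cintegral `[al, s] (fun r => mu f g r (P c d a)).
Proof.
move=> sf sg al0 als cst Ca; have s0 := le_trans al0 als.
have [h [hP ih hE]] := mu_integral sf sg Ca.
have [iR iI] := ih s s0.
have [vR vI] := mu_integrable sf sg al0 als (rconv_in (bounded_chi c d) Ca).
have hv r : al <= r < s -> h r = mu f g r (P c d a).
  move=> hr; have [fc gd] := cst r hr; rewrite hP ?fc ?gd//.
  by case/andP: hr => ar _; exact: le_trans ar.
rewrite hE// [in RHS]hE// -addrA; congr (_ + _).
rewrite /cintegral (Rintegral_cut al0 als iR vR) => [|r hr]; last by rewrite /= hv.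
by rewrite (Rintegral_cut al0 als iI vI) => [//|r hr]; rewrite /= hv.
Qed.

Let mu_Taylor f g c d (al be : R) : step_fun f -> step_fun g -> 0 <= al -> al <= be ->
  (forall r, al <= r < be -> f r = c /\ g r = d) ->
  exists M K : R, [/\ 0 <= M, 0 <= K & forall n s a, al <= s <= be -> CC a ->
    rnorm (mu f g s a - \sum_(j < n) (tpow al j s)%:C * mu f g al (iter j (P c d) a) : R[i]^o)
    <= 2 * (M * rnorm a * K ^+ n * tpow al n s)].
Proof.
move=> sf sg al0 albe cst.
have [M M0 hM] := mu_uniform sf sg (le_trans al0 albe).
have [K K0 hK] := P_bound c d.
exists M, K; split=> // n s a hs Ca.
(* The n-th derivative of s -> mu_s(a) is s -> mu_s(P^n a), which has modulus at most M K^n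
   rnorm(a). *)
apply: (@Taylor_complex _ (fun n s => mu f g s (iter n (P c d) a)) al be) => //.
- by rewrite mulr_ge0 ?rnorm_ge0.
- move=> {hs}n {}s /andP[als sbe]; apply: le_trans (hM s _ _ _) _.
  + by rewrite (le_trans al0 als).
  + exact: P_in.
  + by rewrite -mulrA ler_wpM2l// mulrC hK.
- move=> {hs}n {}s /andP[als sbe]; split; first by apply: mu_integrable => //; exact: P_in.
  apply: mu_step => //; last exact: P_in.
  by move=> r /andP[ar rs]; apply: cst; rewrite ar (lt_le_trans rs).
Qed.

(* Partial sums of exp(tP). *)
Let E c d n (t : R) a := \sum_(j < n) (tpow 0 j t)%:C *: iter j (P c d) a.

Let E_in c d n t a : CC a -> CC (E c d n t a).
Proof.
by move=> Ca; apply: subspace_sum => // j; apply: subspaceZ => //; exact: P_in.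
Qed.

Let bounded_iterP c d j : bounded_on CC (iter j (P c d)).
Proof.
elim: j => [|j IH].
  by split=> //; exists 1 => // a _; rewrite mul1r.
exact: (bounded_on_comp (fun a => @P_in c d j a) (bounded_rconv (bounded_chi c d)) IH).
Qed.

Let bounded_E c d n t : bounded_on CC (E c d n t).
Proof.
exact: (bounded_on_sum n (fun j => (tpow 0 j t)%:C) (bounded_iterP c d)).
Qed.

Let bounded_epsE c d n t : bfun (eps \o E c d n t).
Proof.
apply: bounded_on_comp (bounded_eps C) (bounded_E c d n t); exact: E_in.
Qed.

(** A polynomial in P commutes with the left convolutions because P does, so already each partial
    sum is the convolution operator of its own functional. *)
Let rconv_epsE c d n t a : CC a -> rconv (eps \o E c d n t) a = E c d n t a.
Proof.
apply: rconv_of_commute; [exact: bounded_E|exact: E_in|move=> xi eta b Cb].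
have bv := bounded_vec xi eta; have [lv _] := bounded_lconv bv.
rewrite /E (linear_on_sum sC lv) => [|j]; last by apply: subspaceZ => //; exact: P_in.
apply: eq_bigr => j _; rewrite (linear_onZ sC lv); last exact: P_in.
congr (_ *: _); elim: (j : nat) => //= i <-.
by apply: lconv_rconv => //; exact: P_in.
Qed.

Let apply_E (rho : bop (os_H C) -> R[i]^o) c d n t a : bfun rho -> CC a ->
  rho (E c d n t a) = \sum_(j < n) (tpow 0 j t)%:C * rho (iter j (P c d) a).
Proof.
move=> [lrho _] Ca; rewrite /E (linear_on_sum sC lrho) => [|j]; last first.
  by apply: subspaceZ => //; exact: P_in.
by apply: eq_bigr => j _; rewrite (linear_onZ sC lrho)//; exact: P_in.
Qed.

Local Notation lam := (assoc_functional l).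

Let bounded_lam c d (t : R) : 0 <= t -> bfun (lam c d t).
Proof.
move=> t0; apply: (@bounded_onZ _ _ R[i]^o).
by apply: bounded_mu => //; exact: step_cst.
Qed.

Let kappa c d (t : R) : 0 <= t ->
  dot (ev F (restr `[0, t[ (fun=> c))) (ev F (restr `[0, t[ (fun=> d))) =
  cexp (t%:C * dot c d).
Proof. by move=> t0; rewrite dot_ev dot_L2_cst. Qed.

Let tpow0E j (al s : R) : tpow al j s = tpow 0 j (s - al).
Proof. by rewrite /tpow subr0. Qed.

Let cst_restr c d (t r : R) : 0 <= r < t ->
  restr `[0, t[ (fun=> c) r = c /\ restr `[0, t[ (fun=> d) r = d.
Proof. by move=> h; rewrite !restrE mem_setE in_itv /= h. Qed.

(** Expansion at time 0, where mu_0 is exp(t<c,d>) eps; this factor is cancelled by the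
    normalization of the associated functional. The error is uniform on the unit ball, so the
    convergence is in norm. *)
Let lam_series c d (t : R) : 0 <= t -> exists D K : R, 0 <= D /\
  forall n a, CC a -> rnorm (lam c d t a - eps (E c d n t a)) <=
    D * exp_coeff (K * t) n * rnorm a.
Proof.
move=> t0; have sc := step_cst c t0; have sd := step_cst d t0.
have [M [K [M0 K0 H]]] := mu_Taylor (c := c) (d := d) sc sd (lexx 0) t0 (@cst_restr c d t).
pose z := cexp (- (t%:C * dot c d)).
exists (rnorm (z : R[i]^o) * (2 * M)), K; split.
  by rewrite !mulr_ge0 ?rnorm_ge0.
move=> n a Ca; have tt : 0 <= t <= t by rewrite t0 lexx.
pose nu := mu (restr `[0, t[ (fun=> c)) (restr `[0, t[ (fun=> d)).
have -> : lam c d t a - eps (E c d n t a) =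
    z * (nu t a - \sum_(j < n) (tpow 0 j t)%:C * nu 0 (iter j (P c d) a)).
  rewrite mulrBr; congr (_ - _); rewrite (apply_E _ _ _ _ (bounded_eps C))// mulr_sumr.
  apply: eq_bigr => j _; rewrite /nu mu0//; last exact: P_in.
  by rewrite mulrCA (mulrA z) kappa// cexpNK mul1r.
rewrite rnormM -!mulrA ler_wpM2l ?rnorm_ge0//; apply: le_trans (H n t a tt Ca) _.
rewrite /exp_coeff /= exprMn /tpow subr0.
by rewrite le_eqVlt; apply/orP; left; apply/eqP; ring.
Qed.

(** P_chi is linear in chi and, since Delta is contractive, has norm at most that of chi. *)
Let rconv_approx (chi1 chi2 : bop (os_H C) -> R[i]^o) (D : R) a :
  bfun chi1 -> bfun chi2 -> 0 <= D ->
  (forall b, CC b -> rnorm (chi1 b - chi2 b) <= D * rnorm b) -> CC a ->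
  rnorm (rconv chi1 a - rconv chi2 a) <= D * rnorm a.
Proof.
move=> b1 b2 D0 hD Ca.
have b12 : bfun (fun b => chi1 b - chi2 b).
  have := bounded_onD b1 (bounded_onZ (-1) b2).
  by under [X in bounded_on CC X -> _]eq_fun do rewrite scaleN1r.
suff <- : rconv (fun b => chi1 b - chi2 b) a = rconv chi1 a - rconv chi2 a.
  exact: rnorm_rconv.
apply: bop_dot_ext => x y; rewrite bopB dotBr.
have bv := bounded_vec x y.
by rewrite (rconv_lconv bv b12 Ca) (rconv_lconv bv b1 Ca) (rconv_lconv bv b2 Ca).
Qed.

(** With E_n the partial sums for time s - al, mu_s(a) is close to mu_al(E_n a) by Taylor's formula.
    This equals mu_al(P_(eps o E_n) a), and eps o E_n is close in norm to lambda_(s-al). *)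
Let mu_conv f g c d (al s : R) a : step_fun f -> step_fun g -> 0 <= al -> al <= s ->
  (forall r, al <= r < s -> f r = c /\ g r = d) -> CC a ->
  mu f g s a = mu f g al (rconv (lam c d (s - al)) a).
Proof.
move=> sf sg al0 als cst Ca.
have [M [K [M0 K0 H]]] := mu_Taylor sf sg al0 als cst.
have sal : 0 <= s - al by rewrite subr_ge0.
have [D [K' [D0 H']]] := lam_series c d sal.
have bal := bounded_mu sf sg al0.
have [lal [N N0 hN]] := bal.
have bl := bounded_lam c d sal.
pose t := s - al.
(* Both errors are terms of exponential series. The absolute value is there because [lam_series]
   gives no sign for [K']. *)
apply: (@rnorm_eq_cvg0 _ R[i]^o _ _ (fun n => 2 * (M * rnorm a) * exp_coeff (K * t) n +
  N * (D * rnorm a) * exp_coeff (`|K'| * t) n)).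
  have -> : (0 : R) = 2 * (M * rnorm a) * 0 + N * (D * rnorm a) * 0 by rewrite !mulr0 addr0.
  by apply: cvgD; apply: cvgMr; exact: cvg_exp_coeff.
move=> n; apply: le_trans (rnorm_tri (mu f g al (E c d n t a) : R[i]^o) _ _) _.
apply: lerD.
  rewrite (apply_E _ _ _ _ bal)//.
  under eq_bigr do rewrite -tpow0E.
  have ss : al <= s <= s by rewrite als lexx.
  apply: le_trans (H n s a ss Ca) _.
  rewrite tpow0E /exp_coeff /= exprMn /tpow subr0 -/t.
  by rewrite le_eqVlt; apply/orP; left; apply/eqP; ring.
rewrite -rconv_epsE// -(linear_onB lal); [|exact: rconv_in|exact: rconv_in].
apply: le_trans (hN _ _) _; first by apply: (subspaceB sC); exact: rconv_in.
rewrite -!mulrA ler_wpM2l// [_ * exp_coeff _ _]mulrC mulrA.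
apply: rconv_approx => //; first by rewrite mulr_ge0// exp_coeff_ge0// mulr_ge0.
move=> b Cb; rewrite rnormBC; apply: le_trans (H' n b Cb) _.
rewrite ler_wpM2r ?rnorm_ge0// ler_wpM2l//.
rewrite /exp_coeff /= ler_wpM2r ?invr_ge0//.
apply: le_trans (ler_norm _) _; rewrite normrX normrM (ger0_norm sal) lexx//.
Qed.

Lemma solution_weak_cocycle : weak_cocycle l.
Proof.
have [_ wb _] := hl; split=> //; first by move=> a u; exact: (weak_solution0 hl).
move=> f g t a n tau sf sg t0 Ca tau0 taun tauS ft gt disc.
have sft : step_fun ft by exact: step_restr.
have sgt : step_fun gt by exact: step_restr.
have tau_le i j : (i <= j <= n)%N -> tau i <= tau j.
  move=> /andP[ij jn]; rewrite -(subnKC ij) in jn *.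
  elim: (j - i)%N jn => [|m IH]; rewrite ?addn0// addnS => h.
  by apply: le_trans (tauS _ h); exact: IH (ltnW h).
have tau_ge0 i : (i <= n)%N -> 0 <= tau i.
  by move=> i_n; rewrite -tau0; apply: tau_le; rewrite leq0n.
pose lam_ i := lam (f (tau i)) (g (tau i)) (tau i.+1 - tau i).
have blam i : (i < n)%N -> bfun (lam_ i).
  by move=> i_n; apply: bounded_lam; rewrite subr_ge0 tauS.
have step i b : (i < n)%N -> CC b -> mu ft gt (tau i.+1) b = mu ft gt (tau i) (rconv (lam_ i) b).
  move=> i_n Cb; apply: mu_conv => //; [exact: tau_ge0 (ltnW i_n)|exact: tauS|].
  move=> r /andP[ir ri].
  have iS : tau i < tau i.+1 := le_lt_trans ir ri.
  have St : tau i.+1 <= t by rewrite -taun; apply: tau_le; rewrite i_n leqnn.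
  (* A discontinuity strictly between two consecutive points would be some [tau j], against
     monotonicity. *)
  have cont (x : R) : tau i < x < tau i.+1 ->
      {for x, continuous ft} /\ {for x, continuous gt}.
    move=> /andP[ix xi].
    apply: contrapT => nc; have [|j jn jx] := disc x.
      have [cf|] := pselect {for x, continuous ft}; last by left.
      by right => cg; apply: nc.
    have [ji|ij] := leqP j i.
      by have := tau_le j i; rewrite ji (ltnW i_n) jx => /(_ isT); rewrite leNgt ix.
    by have := tau_le i.+1 j; rewrite ij jn jx => /(_ isT); rewrite leNgt xi.
  have it : 0 <= tau i < t by rewrite tau_ge0 ?(ltnW i_n)// (lt_le_trans iS).
  have hr : tau i <= r < tau i.+1 by rewrite ir.
  rewrite (const_of_continuous sft (fun x hx => (cont x hx).1) hr).
  rewrite (const_of_continuous sgt (fun x hx => (cont x hx).2) hr).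
  by rewrite /ft /gt !restrE mem_setE in_itv /= it.
(* The product of the factors from index i on. It is nested to the right and grows at its left end,
   so the intervals are peeled off backwards from t. *)
pose B i := \big[@convol R C / eps]_(i <= j < n) lam_ j.
have BS i : (i < n)%N -> B i = convol (lam_ i) (B i.+1).
  by move=> i_n; rewrite /B big_ltn.
have bB m : (m <= n)%N -> bfun (B (n - m)%N).
  elim: m => [|m IH] mn; first by rewrite subn0 /B big_geq//; exact: bounded_eps.
  have h : (n - m.+1 < n)%N by rewrite ltn_subrL (leq_trans _ mn).
  rewrite BS// -subSn// subSS; apply: bounded_convol; first exact: blam.
  exact: IH (ltnW mn).
have telescope m b : (m <= n)%N -> CC b ->
    mu ft gt (tau n) b = mu ft gt (tau (n - m)%N) (rconv (B (n - m)%N) b).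
  elim: m => [|m IH] mn Cb; first by rewrite subn0 /B big_geq// rconv_eps.
  have h : (n - m.+1 < n)%N by rewrite ltn_subrL (leq_trans _ mn).
  have bm := bB m (ltnW mn).
  have e : (n - m)%N = (n - m.+1).+1 by rewrite -subSn// subSS.
  rewrite e in IH bm; rewrite (IH (ltnW mn) Cb) (BS _ h).
  by rewrite (rconv_convol (blam _ h) bm Cb) -step//; exact: rconv_in.
(* At time 0 there remains <e(f), e(g)> eps(P_(B 0) a), that is <e(f), e(g)> times (B 0)(a); the
   normalizing exponential cancels the inner product. *)
have := telescope n a (leqnn n) Ca; rewrite subnn tau0 taun mu0//; last first.
  by apply: rconv_in => //; have := bB n (leqnn n); rewrite subnn.
rewrite /mu => ->; rewrite mulrA dot_ev cexpNK mul1r.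
have := bB n (leqnn n); rewrite subnn => b0.
by rewrite (eps_rconv b0 Ca) /B big_mkord.
Qed.

(** The functionals lambda_t at different t are defined with different test vectors. On a common
    horizon T they become comparable, at the cost of one factor that does not depend on t. *)
Let mu_lam c d (t T : R) a : 0 <= t -> t <= T -> CC a ->
  mu (restr `[0, T[ (fun=> c)) (restr `[0, T[ (fun=> d)) t a =
  cexp (T%:C * dot c d) * lam c d t a.
Proof.
move=> t0 tT Ca; have T0 := le_trans t0 tT.
rewrite (@mu_conv _ _ c d 0) ?subr0//; try exact: step_cst; last first.
  by move=> r /andP[r0 rt]; apply: cst_restr; rewrite r0 (lt_le_trans rt).
have bl := bounded_lam c d t0.
by rewrite mu0 ?kappa ?eps_rconv//; [exact: step_cst|exact: step_cst|exact: rconv_in].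
Qed.

Lemma solution_conv_semigroup c d : conv_semigroup (lam c d).
Proof.
split=> [t t0|a Ca|s t a s0 t0 Ca].
- by have [ll [M _ hM]] := bounded_lam c d t0; split => //; exists M.
- have h := mu_lam c d (lexx 0) (lexx 0) Ca.
  rewrite mu0 ?kappa ?mul0r ?cexp0 ?mul1r// in h; try exact: step_cst.
- have bs := bounded_lam c d s0; have bt := bounded_lam c d t0.
  rewrite convolE//; have st0 := addr_ge0 s0 t0.
  have hs : s <= s + t by rewrite lerDl.
  have := mu_lam c d st0 (lexx _) Ca.
  (* With horizon s + t, the stretch from s to s + t contributes lambda_t and the one before it
     lambda_s, under the same exponential factor as on the left side. *)
  rewrite (@mu_conv _ _ c d s (s + t)) ?[s + t - s]addrAC ?subrr ?add0r//;
    try exact: step_cst; last first.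
    by move=> r /andP[sr rst]; apply: cst_restr; rewrite rst (le_trans s0).
  rewrite mu_lam//; last exact: rconv_in.
  move=> /(congr1 (fun z => cexp (- ((s + t)%:C * dot c d)) * z)).
  by rewrite !cexpNKl => ->.
Qed.

(** Taylor's formula with a single term, on the common horizon 1, gives the Lipschitz bound D t for
    the norm of lambda_t - eps when t is in [0, 1]. *)
Lemma solution_norm_cts_at0 c d : norm_cts_at0 (lam c d).
Proof.
have sc := step_cst c (@ler01 R); have sd := step_cst d (@ler01 R).
have [M [K [M0 K0 H]]] := mu_Taylor (c := c) (d := d) sc sd (lexx 0) ler01 (@cst_restr c d 1).
pose z := cexp (- (1%:C * dot c d)).
pose D := rnorm (z : R[i]^o) * (2 * (M * K)).
have D0 : 0 <= D by rewrite !mulr_ge0 ?rnorm_ge0.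
have bnd (t : R) a : 0 <= t <= 1 -> CC a -> rnorm (lam c d t a - eps a) <= D * t * rnorm a.
  move=> h Ca; have /andP[t0 t1] := h; have := H 1%N t a h Ca.
  rewrite big_ord1 [tpow 0 (nat_of_ord _) t](_ : _ = 1); last first.
    by rewrite /tpow /= expr0 fact0 divr1.
  rewrite [tpow 0 1 t](_ : _ = t) ?mul1r /=; last first.
    by rewrite /tpow subr0 expr1 -[1`!]/1%N divr1.
  rewrite mu_lam// mu0// kappa// -mulrBr => hb.
  have -> : lam c d t a - eps a = z * (cexp (1%:C * dot c d) * (lam c d t a - eps a)).
    by rewrite cexpNKl.
  rewrite rnormM; apply: le_trans (ler_wpM2l (rnorm_ge0 _) hb) _; rewrite /D.
  by rewrite le_eqVlt; apply/orP; left; apply/eqP; ring.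
have fle (t : R) : 0 <= t <= 1 -> 0 <= fnorm (fun a => lam c d t a - eps a) <= D * t.
  move=> /andP[t0 t1].
  have C0 := sC.1.
  have S0 : [set rnorm (lam c d t a - eps a) | a in [set a | CC a /\ rnorm a <= 1]] !=set0.
    by exists (rnorm (lam c d t 0 - eps 0)), 0 => //=; rewrite rnorm0.
  have ub : ubound [set rnorm (lam c d t a - eps a) | a in [set a | CC a /\ rnorm a <= 1]] (D * t).
    move=> _ [a [/= Ca a1] <-]; apply: le_trans (bnd t a _ Ca) _; first by rewrite t0.
    by rewrite -[leRHS]mulr1 ler_wpM2l// mulr_ge0.
  apply/andP; split; last exact: ge_sup.
  apply: (le_trans (rnorm_ge0 (lam c d t 0 - eps 0 : R[i]^o))).
  by apply: ub_le_sup; [exists (D * t)|exists 0 => //=; rewrite rnorm0].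
rewrite /norm_cts_at0; apply: (@squeeze_cvgr _ _ _ _ (fun=> 0) (fun t => D * t)).
- near=> t; apply: fle; apply/andP; split; first by apply: ltW; near: t; exact: nbhs_right_gt.
  by near: t; apply: nbhs_right_le; exact: ltr01.
- exact: cvg_cst.
- rewrite -[X in _ --> X](mulr0 D); apply: cvgMr; apply: cvg_at_right_filter; exact: cvg_id.
Unshelve. all: by end_near. Qed.

End Cocycle.

Theorem theorem4p4p6 (R : realType) (C : os_coalgebra R) (k : hilbertType R)
    (L : L2_space k) (F : fock_space L)
    (phi : bop (os_H C) -> bop (khat k)) (hphi : completely_bounded phi)
    (l : R -> bop (os_H C) -> F -> F) (hl : weak_solution phi l) :
  weak_cocycle l /\
  forall c d : k, conv_semigroup (assoc_functional l c d) /\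
                  norm_cts_at0 (assoc_functional l c d).
Proof.
split; first exact: solution_weak_cocycle hphi hl.
move=> c d; split; first exact: solution_conv_semigroup hphi hl c d.
exact: solution_norm_cts_at0 hphi hl c d.
Qed.
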